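(* Let $M$ be a compact 4-dimensional manifold with an integrable almost complex structure $J$. Then, for $p+q=2$, under the natural identification of $H^{p,q}_{\bar\partial}(M)$ with a subspace of $H^2(M;\mathbb{C})$, $$H_J^{p,q}=H_{\bar\partial}^{p,q},$$ and $$H_J^{+}=H_{\bar\partial}^{1,1}\cap H^2(M;\mathbb{R}),\qquad H_J^{-}=(H_{\bar\partial}^{2,0}\oplus H_{\bar\partial}^{0,2})\cap H^2(M;\mathbb{R}).$$
   Context: Manifolds are smooth, without boundary. $H_J^{p,q}$ ($p+q=2$) is the subspace of $H^2(M;\mathbb{C})$ of de Rham classes which can be represented by a $d$-closed complex form of type $(p,q)$. $H_J^{+}$ (resp. $H_J^-$) is the subspace of $H^2(M;\mathbb{R})$ of classes which can be represented by closed real 2-forms $\alpha$ with $\alpha(J\cdot,J\cdot)=\alpha$ (resp. $\alpha(J\cdot,J\cdot)=-\alpha$). $H^{p,q}_{\bar\partial}(M)$ is the Dolbeault cohomology group. Identification: let $F^p(H^2)\subseteq H^2(M;\mathbb{C})$ be the set of classes represented by closed forms in $\oplus_{p'+q'=2,\,p'\ge p}\Omega^{p',q'}$. For a compact complex surface it is known that the Fr\''olicher spectral sequence $E_1^{p,q}=H^{p,q}_{\bar\partial}(M)\Rightarrow H^{p+q}(M;\mathbb{C})$ degenerates at $E_1$, so that for $p+q=2$ one has $H^{p,q}_{\bar\partial}(M)\cong F^p(H^2)/F^{p+1}(H^2)$ (a class in $F^p(H^2)$ represented by a closed form in $\oplus_{p'\ge p}\Omega^{p',2-p'}$ corresponds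 to the Dolbeault class of its $(p,q)$ component), and that the composition $F^p(H^2)\cap\overline{F^q(H^2)}\hookrightarrow F^p(H^2)\to F^p(H^2)/F^{p+1}(H^2)$ is an isomorphism. Through these isomorphisms $H^{p,q}_{\bar\partial}(M)$ is regarded as the subspace $F^p(H^2)\cap\overline{F^q(H^2)}$ of $H^2(M;\mathbb{C})$. *)

(* Defs.v *)
From mathcomp Require Import all_boot all_order all_algebra.
From mathcomp Require Import complex.
From mathcomp Require Import all_classical all_reals all_analysis.
Import Order.TTheory GRing.Theory Num.Theory.
Import numFieldNormedType.Exports.

Set Implicit Arguments.
Unset Strict Implicit.
Unset Printing Implicit Defensive.

Local Open Scope classical_set_scope.
Local Open Scope ring_scope.

Section Smooth.
Variables (R : realType) (V W : normedModType R).

Fixpoint differentiable_upto (k : nat) (U : set V) (f : V -> W) : Prop :=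
  if k is k'.+1 then
    (forall x, U x -> differentiable f x) /\
    (forall v, differentiable_upto k' U ('D_v f))
  else True.

Definition smooth_on (U : set V) (f : V -> W) : Prop :=
  forall k, differentiable_upto k U f.

End Smooth.

(* The atlas need not be maximal: tensors and forms are the same for an atlas
   and for the maximal atlas it generates. [of_coord c] is the inverse of the
   chart [to_coord c] on its image and is irrelevant elsewhere.  The
   Hausdorff property is not included; second countability follows from
   compactness. *)
Record atlas (R : realType) (n : nat) (M : topologicalType) := Atlas {
  chart : Type;
  chart_dom : chart -> set M;
  to_coord : chart -> M -> 'rV[R]_n;
  of_coord : chart -> 'rV[R]_n -> M;
  chart_dom_open : forall c, open (chart_dom c);
  chart_img_open : forall c, open (to_coord c @` chart_dom c);
  chart_cover : forall m, exists c, chart_dom c m;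
  to_coordK : forall c m, chart_dom c m -> of_coord c (to_coord c m) = m;
  to_coord_continuous : forall c m,
    chart_dom c m -> {for m, continuous (to_coord c)};
  of_coord_continuous : forall c x,
    (to_coord c @` chart_dom c) x -> {for x, continuous (of_coord c)};
  transition_smooth : forall c d,
    smooth_on (to_coord c @` (chart_dom c `&` chart_dom d))
              (to_coord d \o of_coord c)
}.

Section ComplexGeometry.
Variables (R : realType) (n : nat) (M : topologicalType) (A : atlas R n M).

Local Notation toC := (map_mx (real_complex R)).

Definition chart_img (c : chart A) : set 'rV[R]_n :=
  to_coord c @` chart_dom c.

Definition overlap (c d : chart A) : set 'rV[R]_n :=
  to_coord c @` (chart_dom c `&` chart_dom d).

Definition transition (c d : chart A) : 'rV[R]_n -> 'rV[R]_n :=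
  to_coord d \o of_coord c.

(* Tangent vectors are row vectors in each chart; an endomorphism of the
   tangent bundle acts by multiplication on the right, and so does the
   Jacobian ['J f x]: ['d f x v = v *m 'J f x]. *)

Record almost_complex := AlmostComplex {
  acs : chart A -> 'rV[R]_n -> 'M[R]_n;
  acs_smooth : forall c, smooth_on (chart_img c) (acs c);
  acs_square : forall c x, chart_img c x -> acs c x *m acs c x = - 1%:M;
  acs_compat : forall c d x, overlap c d x ->
    acs c x *m 'J (transition c d) x =
    'J (transition c d) x *m acs d (transition c d x)
}.

Definition lie_bracket (X Y : 'rV[R]_n -> 'rV[R]_n) (x : 'rV[R]_n) : 'rV[R]_n :=
  'D_(X x) Y x - 'D_(Y x) X x.

Definition nijenhuis (J : 'rV[R]_n -> 'M[R]_n) (X Y : 'rV[R]_n -> 'rV[R]_n)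
    (x : 'rV[R]_n) : 'rV[R]_n :=
  let JX y := X y *m J y in
  let JY y := Y y *m J y in
  lie_bracket JX JY x - lie_bracket JX Y x *m J x
    - lie_bracket X JY x *m J x - lie_bracket X Y x.

Definition integrable_acs (J : almost_complex) : Prop :=
  forall (c : chart A) X Y,
    smooth_on (chart_img c) X -> smooth_on (chart_img c) Y ->
    forall x, chart_img c x -> nijenhuis (acs J c) X Y x = 0.

(* Complex differential forms.  A [preform] of degree k gives in every chart,
   at every point, a function of k complexified tangent vectors, the rows of a
   matrix; [is_form] says that these are the local expressions of a smooth
   complex-valued k-form.  Values outside the images of the charts are
   irrelevant, hence [form_eq]. *)

Definition preform (k : nat) : Type :=
  chart A -> 'rV[R]_n -> 'M[R[i]]_(k, n) -> R[i].

Definition form_eq k (w w' : preform k) : Prop :=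
  forall c x V, chart_img c x -> w c x V = w' c x V.

Definition multilinear k (f : 'M[R[i]]_(k, n) -> R[i]) : Prop :=
  forall (V V1 V2 : 'M[R[i]]_(k, n)) i0 (a b : R[i]),
    row i0 V = a *: row i0 V1 + b *: row i0 V2 ->
    row' i0 V1 = row' i0 V -> row' i0 V2 = row' i0 V ->
    f V = a * f V1 + b * f V2.

Definition alternating k (f : 'M[R[i]]_(k, n) -> R[i]) : Prop :=
  forall (V : 'M[R[i]]_(k, n)) i1 i2,
    i1 != i2 -> row i1 V = row i2 V -> f V = 0.

Definition is_form k (w : preform k) : Prop :=
  [/\ forall c x, chart_img c x -> multilinear (w c x) /\ alternating (w c x),
      forall c V, smooth_on (chart_img c) (fun x => complex.Re (w c x V) : R^o)
               /\ smooth_on (chart_img c) (fun x => complex.Im (w c x V) : R^o)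
    & forall c d x V, overlap c d x ->
        w c x V = w d (transition c d x) (V *m toC ('J (transition c d) x))].

Definition partialC (a : 'I_n) (f : 'rV[R]_n -> R[i]) (x : 'rV[R]_n) : R[i] :=
  Complex ('D_(delta_mx 0 a) (fun y => complex.Re (f y) : R^o) x)
          ('D_(delta_mx 0 a) (fun y => complex.Im (f y) : R^o) x).

Definition ext_d k (w : preform k) : preform k.+1 := fun c x V =>
  \sum_(j < k.+1) (-1) ^+ j *
    \sum_(a < n) V j a * partialC a (fun y => w c y (row' j V)) x.

Definition conj_form k (w : preform k) : preform k := fun c x V =>
  conjc (w c x (map_mx conjc V)).

Definition real_form k (w : preform k) : Prop :=
  forall c x (V : 'M[R]_(k, n)), chart_img c x -> complex.Im (w c x (toC V)) = 0.

Definition closed_form k (w : preform k) : Prop :=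
  is_form w /\ form_eq (ext_d w) 0.

(* De Rham cohomology of degree 2.  A class is the set of the closed forms
   that represent it. *)

Definition deRham_class (w : preform 2) : set (preform 2) :=
  [set w' | closed_form w' /\
    exists g : preform 1, is_form g /\ form_eq (w' - w) (ext_d g)].

Definition deRham_classR (w : preform 2) : set (preform 2) :=
  [set w' | [/\ closed_form w', real_form w' &
    exists g : preform 1,
      [/\ is_form g, real_form g & form_eq (w' - w) (ext_d g)]]].

(* The classes in H^2(M; C), resp. H^2(M; R), with a closed representative,
   resp. a closed real representative, satisfying P. *)
Definition represented (P : preform 2 -> Prop) : set (set (preform 2)) :=
  [set deRham_class w | w in [set w | closed_form w /\ P w]].

Definition representedR (P : preform 2 -> Prop) : set (set (preform 2)) :=
  [set deRham_classR w | w in [set w | [/\ closed_form w, real_form w & P w]]].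

Definition H2R : set (set (preform 2)) := representedR (fun=> True).

(* The inclusion of H^2(M; R) in H^2(M; C). *)
Definition complexify (u : set (preform 2)) : set (preform 2) :=
  \bigcup_(w in u) deRham_class w.

(* The intersection of a subspace E of H^2(M; C) with H^2(M; R). *)
Definition real_points (E : set (set (preform 2))) : set (set (preform 2)) :=
  [set u | H2R u /\ E (complexify u)].

Definition class_conj (u : set (preform 2)) : set (preform 2) :=
  (@conj_form 2) @` u.

Definition subspace_conj (E : set (set (preform 2))) : set (set (preform 2)) :=
  class_conj @` E.

Definition class_add (u v : set (preform 2)) : set (preform 2) :=
  [set a + b | a in u & b in v].

Definition subspace_add (E E' : set (set (preform 2))) :
    set (set (preform 2)) :=
  [set class_add u v | u in E & v in E'].

Section Bidegree.
Variable J : almost_complex.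

(* w vanishes on p vectors of type (1,0) and q vectors of type (0,1), in any
   order, unless P p q: w belongs to the sum of the spaces of forms of
   bidegree (p,q) over the (p,q) with P p q.  S is the set of positions of the
   vectors of type (1,0), the eigenvectors of J for 'i. *)
Definition bidegree_in k (P : nat -> nat -> bool) (w : preform k) : Prop :=
  forall c x (V : 'M[R[i]]_(k, n)) (S : {set 'I_k}), chart_img c x ->
    (forall j, row j V *m toC (acs J c x) =
       (if j \in S then 'i%C else - 'i%C) *: row j V) ->
    ~~ P #|S| #|~: S| -> w c x V = 0.

Definition has_bidegree k (p q : nat) (w : preform k) : Prop :=
  bidegree_in (fun a b => (a == p) && (b == q)) w.

Definition proj10 (c : chart A) (x : 'rV[R]_n) : 'M[R[i]]_n :=
  2^-1 *: (1%:M - 'i%C *: toC (acs J c x)).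

Definition proj01 (c : chart A) (x : 'rV[R]_n) : 'M[R[i]]_n :=
  2^-1 *: (1%:M + 'i%C *: toC (acs J c x)).

Definition component k (p q : nat) (w : preform k) : preform k := fun c x V =>
  \sum_(S : {set 'I_k} | (#|S| == p) && (#|~: S| == q))
    w c x (\matrix_j (row j V *m (if j \in S then proj10 c x else proj01 c x))).

(* Meaningful on forms of bidegree (p,q) only. *)
Definition dbar k (p q : nat) (w : preform k) : preform k.+1 :=
  component p q.+1 (ext_d w).

(* The forms of bidegree (p, q-1): only 0 if q = 0, hence [b.+1 == q]. *)
Definition has_bidegree_pred k (p q : nat) (w : preform k) : Prop :=
  bidegree_in (fun a b => (a == p) && (b.+1 == q)) w.

(* Dolbeault cohomology for p + q = 2; a class is the set of its d-bar-closed
   representatives. *)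

Definition dolbeault_cycle (p q : nat) (w : preform 2) : Prop :=
  [/\ is_form w, has_bidegree p q w & form_eq (dbar p q w) 0].

Definition dolbeault_class (p q : nat) (w : preform 2) : set (preform 2) :=
  [set w' | dolbeault_cycle p q w' /\
    exists g : preform 1, [/\ is_form g, has_bidegree_pred p q g
      & form_eq (w' - w) (dbar p q.-1 g)]].

Definition dolbeault (p q : nat) : set (set (preform 2)) :=
  [set dolbeault_class p q w | w in dolbeault_cycle p q].

Definition hodge_filtration (p : nat) : set (set (preform 2)) :=
  represented (bidegree_in (fun a _ => (p <= a)%N)).

(* The natural identification of the Dolbeault class u of bidegree (p,q) with
   the de Rham class e in the intersection of F^p and the conjugate of F^q:
   u is the class of the (p,q) component of a closed representative of e in
   the p-th step of the filtration. *)
Definition identified (p q : nat) (u e : set (preform 2)) : Prop :=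
  (hodge_filtration p `&` subspace_conj (hodge_filtration q)) e /\
  exists w, [/\ closed_form w, bidegree_in (fun a _ => (p <= a)%N) w,
    e = deRham_class w & u = dolbeault_class p q (component p q w)].

Definition dolbeault_subspace (p q : nat) : set (set (preform 2)) :=
  [set e | exists2 u, dolbeault p q u & identified p q u e].

(* The classical consequence of the degeneration at E_1 of the Froelicher
   spectral sequence of a compact complex surface: [identified] is a bijection
   from the Dolbeault group of bidegree (p,q) onto the intersection of F^p and
   the conjugate of F^q. *)
Definition identification_bijective : Prop :=
  forall p q, (p + q = 2)%N ->
    (forall u, dolbeault p q u -> exists! e, identified p q u e) /\
    (forall e, (hodge_filtration p `&` subspace_conj (hodge_filtration q)) e ->
       exists! u, dolbeault p q u /\ identified p q u e).

Definition HJ (p q : nat) : set (set (preform 2)) :=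
  represented (has_bidegree p q).

Definition J_pullback k (w : preform k) : preform k := fun c x V =>
  w c x (V *m toC (acs J c x)).

Definition HJplus : set (set (preform 2)) :=
  representedR (fun w => form_eq (J_pullback w) w).

Definition HJminus : set (set (preform 2)) :=
  representedR (fun w => form_eq (J_pullback w) (- w)).

End Bidegree.
End ComplexGeometry.

(* Main.v *)
Require Import Defs.
From mathcomp Require Import all_boot all_order all_algebra.
From mathcomp Require Import complex ring lra zify.
From mathcomp Require Import all_classical all_reals all_analysis.
Import Order.TTheory GRing.Theory Num.Theory.
Import numFieldNormedType.Exports.

Set Implicit Arguments.
Unset Strict Implicit.
Unset Printing Implicit Defensive.

Local Open Scope classical_set_scope.
Local Open Scope ring_scope.

(** Let F^p be the classes of the closed forms whose components all have first
    degree at least p.  A class of the Dolbeault subspace of bidegree (p,q)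
    lies in F^p and in the conjugate of F^q, and a closed form of pure type
    (p,q) gives such a class because it is its own (p,q) component and hence a
    Dolbeault cycle ([HJ_sub_dolbeault]).  The first equality thus amounts to
    finding, in each class of the intersection of F^p and the conjugate of F^q,
    a closed form of pure type ([filtration_sub_HJ]).  For (2,0) and (0,2) the
    representative at hand is already pure.  For (1,1) there are closed forms a
    and b without (0,2) component such that a - conj b = dg.  Let g10 be the
    (1,0) part of g.  Then a - d g10 is cohomologous to a; it has no (0,2)
    component because neither a nor d g10 has one, and no (2,0) component
    because there d g10 agrees with dg, so that a - d g10 agrees with conj b
    ([filtration11_HJ]).

    Integrability is used in one form: the vector fields of type (0,1) are
    closed under bracket ([integrable_bracket]), hence if a form vanishes as
    soon as one argument is of type (0,1), its differential vanishes as soon as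
    two arguments are ([ext_d1_kills01], [ext_d2_kills01]).

    For 2-forms, J-invariant means of type (1,1) and J-anti-invariant means
    without (1,1) component.  A closed real form without (1,1) component is the
    sum of its (2,0) part w20 and of the conjugate of w20.  By the fact above
    the differentials of the two summands have no type in common, so both
    vanish ([closed_part10]).  This, and taking the real part of a
    representative of a real class ([deRham_classR_re]), gives the two
    descriptions of the real subspaces.

    A class in both the (2,0) and the (0,2) subspace is represented by a closed
    (2,0) form, whose (0,2) component is 0.  It is therefore identified with
    the zero Dolbeault class of bidegree (0,2), as is the zero de Rham class,
    and the identification is one-to-one ([dolbeault_direct]).

    In charts, subtracting d g10 requires that the differential of a 1-form be
    a closed 2-form.  Compatibility with the changes of charts and d d = 0 both
    rest on the symmetry of second derivatives ([derive_comm]). *)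

(** * Smooth maps and symmetry of second derivatives *)

Section SmoothMaps.
Variables (R : realType) (V W : normedModType R).
Implicit Types (U : set V) (f g : V -> W).

Lemma near_eq_differentiable f g (x : V) :
  (\near x, f x = g x) -> differentiable f x -> differentiable g x.
Proof.
move=> fg df.
have nfg : \forall h \near (0 : V), f (h + x) = g (h + x).
  by move: fg; rewrite (near_shift 0) subr0.
have ex : g \o shift x = cst (g x) + 'd f x +o_ 0 id.
  apply/eqaddoP => e e0.
  have /diff_locally/eqaddoP/(_ _ e0) := df.
  apply: filterS2 nfg => h /= fgh; rewrite -(nbhs_singleton fg).
  by rewrite /= !fctE /= -fgh.
apply/diff_locallyP; have -> := diff_unique _ ex; last exact: diff_continuous.
by split=> //; exact: diff_continuous.
Qed.

(** Derivatives are functions on the whole space, but only their values on U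
    are controlled: each computation of a derivative is transported through an
    equality on the open set U. *)
Lemma differentiable_upto_ext k U f g : open U ->
  (forall x, U x -> f x = g x) ->
  differentiable_upto k U f -> differentiable_upto k U g.
Proof.
move=> Uo; elim: k f g => [//|k IH] f g fg /= [df Df].
have nfg x : U x -> \near x, f x = g x.
  by move=> Ux; near=> y; apply: fg; near: y; exact: open_nbhs_nbhs.
split=> [x Ux|v].
  exact: near_eq_differentiable (nfg _ Ux) (df _ Ux).
by apply: IH (Df v) => x Ux; apply: near_eq_derive; exact: nfg.
Unshelve. all: by end_near. Qed.

Lemma smooth_on_ext U f g : open U -> (forall x, U x -> f x = g x) ->
  smooth_on U f -> smooth_on U g.
Proof. by move=> Uo fg sf k; exact: differentiable_upto_ext (sf k). Qed.

Lemma differentiable_uptoW k U f :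
  differentiable_upto k.+1 U f -> differentiable_upto k U f.
Proof.
elim: k f => [//|k IH] f [df Df]; split=> // v; exact: IH (Df v).
Qed.

Lemma smooth_on_differentiable U f x : smooth_on U f -> U x -> differentiable f x.
Proof. by move=> /(_ 1%N)[+ _]; exact. Qed.

Lemma smooth_on_derive U f v : smooth_on U f -> smooth_on U ('D_v f).
Proof. by move=> sf k; have [_] := sf k.+1; exact. Qed.

Lemma smooth_on_cst U (a : W) : smooth_on U (fun=> a).
Proof.
move=> k; elim: k a => [//|k IH] a; split=> [x _|v].
  exact: differentiable_cst.
have -> : 'D_v (fun=> a : W) = fun=> 0 by apply/funext => x; rewrite derive_cst.
exact: IH.
Qed.

Lemma differentiable_uptoD k U f g : open U ->
  differentiable_upto k U f -> differentiable_upto k U g ->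
  differentiable_upto k U (fun x => f x + g x).
Proof.
move=> Uo; elim: k f g => [//|k IH] f g [df Df] [dg Dg]; split=> [x Ux|v].
  by apply: differentiableD; [exact: df|exact: dg].
apply: (@differentiable_upto_ext _ _ (fun x => 'D_v f x + 'D_v g x)) => //.
  by move=> x Ux; rewrite -deriveD//; apply: diff_derivable; [exact: df|exact: dg].
by apply: IH; [exact: Df|exact: Dg].
Qed.

Lemma smooth_onD U f g : open U -> smooth_on U f -> smooth_on U g ->
  smooth_on U (fun x => f x + g x).
Proof. by move=> Uo sf sg k; exact: differentiable_uptoD. Qed.

End SmoothMaps.

Section SmoothFunctions.
Variables (R : realType) (V : normedModType R).
Implicit Types (U : set V) (f g : V -> R^o).

Lemma differentiable_uptoM k U f g : open U ->
  differentiable_upto k U f -> differentiable_upto k U g ->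
  differentiable_upto k U (fun x => f x * g x : R^o).
Proof.
move=> Uo; elim: k f g => [//|k IH] f g sf sg; split=> [x Ux|v].
  by apply: differentiableM; [exact: sf.1|exact: sg.1].
apply: (@differentiable_upto_ext _ _ _ _ _
  (fun x => f x * 'D_v g x + g x * 'D_v f x)) => //.
  move=> x Ux; apply/esym.
  by apply: (@deriveM _ _ f g); apply: diff_derivable; [exact: sf.1|exact: sg.1].
by apply: differentiable_uptoD => //; apply: IH;
  by [exact: differentiable_uptoW|exact: sf.2|exact: sg.2].
Qed.

Lemma smooth_onM U f g : open U -> smooth_on U f -> smooth_on U g ->
  smooth_on U (fun x => f x * g x : R^o).
Proof. by move=> Uo sf sg k; exact: differentiable_uptoM. Qed.

Lemma smooth_onN U f : open U -> smooth_on U f -> smooth_on U (fun x => - f x : R^o).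
Proof.
move=> Uo sf; apply: (@smooth_on_ext _ _ _ _ (fun x => (-1) * f x : R^o)) => //.
  by move=> x _; rewrite mulN1r.
by apply: smooth_onM => //; exact: smooth_on_cst.
Qed.

Lemma smooth_on_entry m n U (F : V -> 'M[R]_(m, n)) i j : open U ->
  smooth_on U F -> smooth_on U (fun x => F x i j : R^o).
Proof.
move=> Uo sf k; elim: k F sf => [//|k IH] F sf; split=> [x Ux|v].
  apply: (@differentiable_comp _ _ _ _ F (fun N : 'M[R]_(m, n) => N i j)).
    exact: smooth_on_differentiable Ux.
  exact: differentiable_coord.
apply: (@differentiable_upto_ext _ _ _ _ _ (fun x => 'D_v F x i j : R^o)) => //.
  move=> x Ux; rewrite derive_mx ?mxE//.
  apply: diff_derivable; exact: smooth_on_differentiable Ux.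
by apply: IH; exact: smooth_on_derive.
Qed.

End SmoothFunctions.

Lemma derive_sum_delta (R : realType) n (f : 'rV[R]_n -> R^o) (x v : 'rV[R]_n) :
  differentiable f x -> 'D_v f x = \sum_a v 0 a * 'D_(delta_mx 0 a) f x.
Proof.
move=> df; rewrite deriveE// {1}(row_sum_delta v) linear_sum /=.
by apply: eq_bigr => a _; rewrite linearZ deriveE.
Qed.

Lemma derive_chain (R : realType) n m (f : 'rV[R]_n -> 'rV[R]_m)
   (h : 'rV[R]_m -> R^o) (x v : 'rV[R]_n) :
  differentiable f x -> differentiable h (f x) ->
  'D_v (fun y => h (f y) : R^o) x = \sum_b 'D_v f x 0 b * 'D_(delta_mx 0 b) h (f x).
Proof.
move=> df dh; rewrite (_ : (fun y => _) = h \o f)//.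
rewrite deriveE; last exact: differentiable_comp.
by rewrite diff_comp//= -deriveE// derive_sum_delta// -deriveE.
Qed.

Section Schwarz.
Variables (R : realType) (V : normedModType R).
Implicit Types (f : V -> R^o) (u v x c : V).

Lemma is_derive_line f u c (t : R) : differentiable f (t *: u + c) ->
  is_derive t 1 (fun s : R => f (s *: u + c)) ('D_u f (t *: u + c)).
Proof.
move=> df.
have E : (fun h : R => h^-1 *: (((fun s : R =>
  f (s *: u + c)) \o shift t) (h *: 1) - f (t *: u + c)))
  = (fun h => h^-1 *: ((f \o shift (t *: u + c)) (h *: u) - f (t *: u + c))).
  by apply/funext => h /=; rewrite scalerDl addrA [h *: (1 : R)]mulr1.
have /diff_derivable : differentiable f (t *: u + c) by [].
move=> /(_ u); rewrite /derivable -E => d.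
by split => //; rewrite /derive -E.
Qed.

(** Mean value theorem in the direction u for the increment of f in the
    direction v, then first-order expansion of ['D_u f] at x. *)
Lemma second_difference f u v x (e : R) :
  (\forall y \near x, differentiable f y) -> differentiable ('D_u f) x -> 0 < e ->
  \forall h \near (0 : R)^'+,
    `|f (h *: u + (h *: v + x)) - f (h *: u + x) - (f (h *: v + x) - f x)
      - h ^+ 2 * 'D_v ('D_u f) x| <= e * h ^+ 2.
Proof.
move=> df dDf e0.
set G := 'D_u f in dDf *.
(* every point considered is within h * N of x; the summand 1 makes N positive *)
set N := `|u| + `|v| + 1.
have N0 : 0 < N by rewrite ltr_wpDl// addr_ge0.
have e'0 : 0 < e / (2 * N) by rewrite divr_gt0// mulr_gt0.
have /diff_locally/eqaddoP/(_ _ e'0) dG := dDf.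
have : \forall k \near (0 : V), differentiable f (k + x) /\
    `|G (k + x) - (G x + 'd G x k)| <= e / (2 * N) * `|k|.
  by move: df; rewrite (near_shift 0) subr0 => df; exact: filterI.
move=> /nbhs_norm0P[d /= d0 H].
near=> h.
have h0 : 0 < h by near: h; exact: nbhs_right_gt.
have hd : h * N < d.
  rewrite -ltr_pdivlMr//; near: h; apply: nbhs_right_lt; exact: divr_gt0.
have small (t s : R) : 0 <= t <= h -> 0 <= s <= h -> `|t *: u + s *: v| <= h * N.
  move=> /andP[t0 th] /andP[s0 sh].
  rewrite (le_trans (ler_normD _ _))// !normrZ !ger0_norm//.
  rewrite (@le_trans _ _ (h * `|u| + h * `|v|))//.
    by rewrite lerD// ler_wpM2r.
  by rewrite /N -mulrDr ler_wpM2l ?(ltW h0)// lerDl.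
pose phi (t : R) := f (t *: u + (h *: v + x)) - f (t *: u + x).
have hh : 0 <= h <= h by rewrite lexx ltW.
have oo : 0 <= (0 : R) <= h by rewrite lexx ltW.
have dphi t : 0 <= t <= h -> is_derive t 1 phi (G (t *: u + (h *: v + x)) -
  G (t *: u + x)).
  move=> th; apply: is_deriveB; apply: is_derive_line.
    have [|+ _] := H (t *: u + h *: v); last by rewrite addrA.
    by rewrite /= (le_lt_trans _ hd)// small.
  have [|+ _] := H (t *: u); last by [].
  by rewrite /= (le_lt_trans _ hd)// -[t *: u]addr0 -(scale0r v) small.
have [|||t] := @MVT _ phi (fun t => G (t *: u + (h *: v + x)) - G (t *: u + x)) 0 h.
- exact: h0.
- by move=> t; rewrite in_itv/= => /andP[t0 th]; apply: dphi; rewrite !ltW.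
- apply: derivable_within_continuous => t; rewrite in_itv/= => th.
  by have [] := dphi _ th.
rewrite in_itv/= => /andP[t0 th].
rewrite /phi !scale0r !add0r subr0 => E.
have tt : 0 <= t <= h by rewrite !ltW.
have est k : `|k| <= h * N -> `|G (k + x) - (G x + 'D_k G x)| <= e / 2 * h.
  move=> kd; have [|_] := H k; first by rewrite /= (le_lt_trans _ hd).
  rewrite -deriveE// => /le_trans; apply.
  rewrite (le_trans (ler_wpM2l (ltW e'0) kd))// le_eqVlt; apply/orP; left.
  by apply/eqP; field; rewrite gt_eqF.
have := est _ (small _ _ tt hh).
have lin (a b : R) : 'D_(a *: u + b *: v) G x = a * 'D_u G x + b * 'D_v G x.
  by rewrite !deriveE// linearD !linearZ.
have := est (t *: u + 0 *: v) (small _ _ tt oo).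
rewrite !lin scale0r addr0 mul0r addr0.
rewrite E [t *: u + (h *: v + x)]addrA => ha hb.
have alg (a b c p q : R^o) : `|a - (c + t * p)| <= e / 2 * h ->
    `|b - (c + (t * p + h * q))| <= e / 2 * h ->
    `|(b - a) * h - h ^+ 2 * q| <= e * h ^+ 2.
  move=> le1 le2.
  have -> : (b - a) * h - h ^+ 2 * q =
     h * ((b - (c + (t * p + h * q))) - (a - (c + t * p))) by ring.
  rewrite normrM gtr0_norm// expr2 mulrCA ler_pM2l//.
  by rewrite (le_trans (ler_normB _ _))// (le_trans (lerD le2 le1))// -mulrDl -splitr.
move: (G (t *: u + x)) (G (t *: u + h *: v + x)) (G x) ('D_u G x) ('D_v G x) ha hb.
exact: alg.
Unshelve. all: by end_near. Qed.

(** The second difference is symmetric in u and v, and approximates h ^+ 2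
    times either mixed derivative. *)
Lemma derive_comm f u v x : (\forall y \near x, differentiable f y) ->
  differentiable ('D_u f) x -> differentiable ('D_v f) x ->
  'D_v ('D_u f) x = 'D_u ('D_v f) x.
Proof.
move=> df du dv; apply/eqP; rewrite -subr_eq0 -normr_le0.
apply/ler_addgt0Pl => e e0; rewrite addr0.
have e2 : 0 < e / 2 by rewrite divr_gt0.
have SA := second_difference v df du e2.
have SB := second_difference u df dv e2.
have [h [[A B] h0]] := filter_ex (filterI (filterI SA SB) (nbhs_right_gt (0 : R))).
rewrite [h *: v + (h *: u + x)]addrCA in B.
have alg (a b c d p q : R^o) : `|a - b - (c - d) - h ^+ 2 * p| <= e / 2 * h ^+ 2 ->
    `|a - c - (b - d) - h ^+ 2 * q| <= e / 2 * h ^+ 2 -> `|p - q| <= e.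
  move=> le1 le2; rewrite -(@ler_pM2l _ (h ^+ 2)) ?exprn_gt0//.
  rewrite -[X in X * `|_|]gtr0_norm ?exprn_gt0// -normrM.
  have -> : h ^+ 2 * (p - q) = (a - c - (b - d) - h ^+ 2 * q) -
     (a - b - (c - d) - h ^+ 2 * p) by ring.
  rewrite (le_trans (ler_normB _ _))// (le_trans (lerD le2 le1))//.
  by rewrite -mulrDl -splitr mulrC.
move: (f (h *: u + (h *: v + x))) (f (h *: u + x)) (f (h *: v +
  x)) (f x) ('D_v _ _) ('D_u _ _) A B.
exact: alg.
Qed.

Lemma smooth_on_derive_comm (U : set V) f u v x : open U -> smooth_on U f -> U x ->
  'D_v ('D_u f) x = 'D_u ('D_v f) x.
Proof.
move=> Uo sf Ux; apply: derive_comm.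
- by near=> y; apply: smooth_on_differentiable sf _; near: y; exact: open_nbhs_nbhs.
- exact: smooth_on_differentiable (smooth_on_derive u sf) Ux.
- exact: smooth_on_differentiable (smooth_on_derive v sf) Ux.
Unshelve. all: by end_near. Qed.

End Schwarz.

(** * Complex-valued functions *)

Section ComplexFunctions.
Variables (R : realType) (n : nat).
Implicit Types (U : set 'rV[R]_n) (f g : 'rV[R]_n -> R[i]) (x : 'rV[R]_n).

(** Real and imaginary parts are handled separately, as in [partialC]. *)
Definition differentiableC f x : Prop :=
  differentiable (fun y => complex.Re (f y) : R^o) x /\
  differentiable (fun y => complex.Im (f y) : R^o) x.

Definition smoothC U f : Prop :=
  smooth_on U (fun y => complex.Re (f y) : R^o) /\
  smooth_on U (fun y => complex.Im (f y) : R^o).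

Lemma smoothC_differentiable U f x : smoothC U f -> U x -> differentiableC f x.
Proof. by move=> [sf sg] Ux; split; exact: smooth_on_differentiable Ux. Qed.

Lemma smoothC_ext U f g : open U -> (forall x, U x -> f x = g x) ->
  smoothC U f -> smoothC U g.
Proof.
by move=> Uo fg [s1 s2]; split; [move: s1|move: s2]; apply: smooth_on_ext => // x Ux;
  rewrite fg.
Qed.

Lemma smoothC_cst U (z : R[i]) : smoothC U (fun=> z).
Proof. by split; exact: smooth_on_cst. Qed.

Lemma smoothCD U f g : open U -> smoothC U f -> smoothC U g ->
  smoothC U (fun x => f x + g x).
Proof.
move=> Uo [f1 f2] [g1 g2]; split.
- apply: (smooth_on_ext Uo _ (smooth_onD Uo f1 g1)) => x _ /=.
  by case: (f x) (g x) => ? ? [].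
- apply: (smooth_on_ext Uo _ (smooth_onD Uo f2 g2)) => x _ /=.
  by case: (f x) (g x) => ? ? [].
Qed.

Lemma smoothCM U f g : open U -> smoothC U f -> smoothC U g ->
  smoothC U (fun x => f x * g x).
Proof.
move=> Uo [f1 f2] [g1 g2]; split.
- apply: (smooth_on_ext Uo _ (smooth_onD Uo (smooth_onM Uo f1 g1)
    (smooth_onN Uo (smooth_onM Uo f2 g2)))) => x _ /=.
  by case: (f x) (g x) => ? ? [].
- apply: (smooth_on_ext Uo _ (smooth_onD Uo (smooth_onM Uo f1 g2)
    (smooth_onM Uo f2 g1))) => x _ /=.
  by case: (f x) (g x) => ? ? [].
Qed.

Lemma smoothC_sum U (I : Type) (r : seq I) (P : pred I)
    (F : I -> 'rV[R]_n -> R[i]) : open U ->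
  (forall i, smoothC U (F i)) -> smoothC U (fun x => \sum_(i <- r | P i) F i x).
Proof.
move=> Uo sF; elim: r => [|i r IH].
  by apply: (smoothC_ext Uo _ (smoothC_cst U 0)) => x _; rewrite big_nil.
case Pi : (P i); last first.
  by apply: (smoothC_ext Uo _ IH) => x _; rewrite big_cons Pi.
by apply: (smoothC_ext Uo _ (smoothCD Uo (sF i) IH)) => x _; rewrite big_cons Pi.
Qed.

Lemma smoothC_conj U f : open U -> smoothC U f -> smoothC U (fun x => conjc (f x)).
Proof.
move=> Uo [f1 f2]; split.
- by apply: (smooth_on_ext Uo _ f1) => x _ /=; case: (f x).
- by apply: (smooth_on_ext Uo _ (smooth_onN Uo f2)) => x _ /=; case: (f x).
Qed.

Lemma smoothC_real U (f : 'rV[R]_n -> R^o) : smooth_on U f ->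
  smoothC U (fun x => real_complex R (f x)).
Proof. by move=> sf; split => //; exact: smooth_on_cst. Qed.

Lemma smoothC_partial U f a : smoothC U f -> smoothC U (partialC a f).
Proof. by move=> [f1 f2]; split; exact: smooth_on_derive. Qed.

Lemma partialC_near a f g x : (\near x, f x = g x) ->
  partialC a f x = partialC a g x.
Proof.
move=> fg; congr Complex; apply: near_eq_derive;
  by apply: filterS fg => y ->.
Qed.

Lemma partialC_ext U a f g x : open U -> U x -> (forall y, U y -> f y = g y) ->
  partialC a f x = partialC a g x.
Proof.
move=> Uo Ux fg; apply: partialC_near.
by near=> y; apply: fg; near: y; exact: open_nbhs_nbhs.
Unshelve. all: by end_near. Qed.

Lemma partialC_cst a (z : R[i]) x : partialC a (fun=> z) x = 0.
Proof. by rewrite /partialC !derive_cst. Qed.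

Lemma partialCD a f g x : differentiableC f x -> differentiableC g x ->
  partialC a (fun y => f y + g y) x = partialC a f x + partialC a g x.
Proof.
move=> [f1 f2] [g1 g2]; rewrite /partialC.
set v := delta_mx _ _.
have d h : differentiable h x -> derivable h x v by move=> ?; exact: diff_derivable.
have -> : (fun y => complex.Re (f y + g y) : R^o) =
    (fun y => complex.Re (f y) : R^o) + (fun y => complex.Re (g y) : R^o).
  by apply/funext => y; rewrite /= !fctE; case: (f y) (g y) => ? ? [].
have -> : (fun y => complex.Im (f y + g y) : R^o) =
    (fun y => complex.Im (f y) : R^o) + (fun y => complex.Im (g y) : R^o).
  by apply/funext => y; rewrite /= !fctE; case: (f y) (g y) => ? ? [].
by rewrite (deriveD (d _ _ f1) (d _ _ g1)) (deriveD (d _ _ f2) (d _ _ g2)).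
Qed.

Lemma differentiableCD f g x : differentiableC f x -> differentiableC g x ->
  differentiableC (fun y => f y + g y) x.
Proof.
move=> [f1 f2] [g1 g2]; split.
- rewrite (_ : (fun y => _) = (fun y => complex.Re (f y) : R^o) + (fun y =>
    complex.Re (g y) : R^o)).
    exact: differentiableD.
  by apply/funext => y; rewrite /= !fctE; case: (f y) (g y) => ? ? [].
- rewrite (_ : (fun y => _) = (fun y => complex.Im (f y) : R^o) + (fun y =>
    complex.Im (g y) : R^o)).
    exact: differentiableD.
  by apply/funext => y; rewrite /= !fctE; case: (f y) (g y) => ? ? [].
Qed.

Lemma differentiableCM f g x : differentiableC f x -> differentiableC g x ->
  differentiableC (fun y => f y * g y) x.
Proof.
move=> [f1 f2] [g1 g2]; split.
- rewrite (_ : (fun y => _) = (fun y => complex.Re (f y) : R^o) * (fun y =>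
    complex.Re (g y) : R^o)
   - (fun y => complex.Im (f y) : R^o) * (fun y => complex.Im (g y) : R^o)).
    by apply: differentiableB; apply: differentiableM.
  by apply/funext => y; rewrite /= !fctE; case: (f y) (g y) => ? ? [].
- rewrite (_ : (fun y => _) = (fun y => complex.Re (f y) : R^o) * (fun y =>
    complex.Im (g y) : R^o)
   + (fun y => complex.Im (f y) : R^o) * (fun y => complex.Re (g y) : R^o)).
    by apply: differentiableD; apply: differentiableM.
  by apply/funext => y; rewrite /= !fctE; case: (f y) (g y) => ? ? [].
Qed.

Lemma differentiableC_cst (z : R[i]) x : differentiableC (fun=> z) x.
Proof. by split; exact: differentiable_cst. Qed.

Lemma partialCM a f g x : differentiableC f x -> differentiableC g x ->
  partialC a (fun y => f y * g y) x = partialC a f x * g x + f x * partialC a g x.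
Proof.
move=> [f1 f2] [g1 g2]; rewrite /partialC.
set v := delta_mx _ _.
set f1' := fun y => complex.Re (f y) : R^o in f1 *.
set f2' := fun y => complex.Im (f y) : R^o in f2 *.
set g1' := fun y => complex.Re (g y) : R^o in g1 *.
set g2' := fun y => complex.Im (g y) : R^o in g2 *.
have d h : differentiable h x -> derivable h x v by move=> ?; exact: diff_derivable.
have -> : (fun y => complex.Re (f y * g y) : R^o) = f1' * g1' - f2' * g2'.
  by apply/funext => y; rewrite /f1' /f2' /g1' /g2' /= !fctE;
    case: (f y) (g y) => ? ? [].
have -> : (fun y => complex.Im (f y * g y) : R^o) = f1' * g2' + f2' * g1'.
  by apply/funext => y; rewrite /f1' /f2' /g1' /g2' /= !fctE;
    case: (f y) (g y) => ? ? [].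
rewrite deriveB; [|apply: derivableM; exact: d..].
rewrite deriveD; [|apply: derivableM; exact: d..].
rewrite !deriveM; [|exact: d..].
rewrite /f1' /f2' /g1' /g2'; case: (f x) (g x) => a1 a2 [b1 b2] /=.
move: ('D_v _ x) ('D_v _ x) ('D_v _ x) ('D_v _ x) => p q r s.
rewrite /GRing.scale /=; congr Complex; ring.
Qed.

Lemma partialC_conj a f x : differentiableC f x ->
  partialC a (fun y => conjc (f y)) x = conjc (partialC a f x).
Proof.
move=> [f1 f2]; rewrite /partialC.
have -> : (fun y => complex.Re (conjc (f y)) : R^o) = (fun y => complex.Re (f y) : R^o).
  by apply/funext => y; case: (f y).
have -> : (fun y => complex.Im (conjc (f y)) : R^o) = - (fun y => complex.Im (f y) :
  R^o).
  by apply/funext => y; rewrite fctE; case: (f y).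
set v := delta_mx _ _.
have d h : differentiable h x -> derivable h x v by move=> ?; exact: diff_derivable.
by rewrite (deriveN (d _ _ f2)).
Qed.

Lemma partialC_comm U a b f x : open U -> smoothC U f -> U x ->
  partialC a (partialC b f) x = partialC b (partialC a f) x.
Proof.
move=> Uo [f1 f2] Ux; rewrite /partialC /=.
by rewrite (smooth_on_derive_comm _ _ Uo f1 Ux) (smooth_on_derive_comm _ _ Uo f2 Ux).
Qed.

End ComplexFunctions.

Lemma partialC_chain (R : realType) n m (f : 'rV[R]_n -> 'rV[R]_m)
    (h : 'rV[R]_m -> R[i]) (x : 'rV[R]_n) a :
  differentiable f x -> differentiableC h (f x) ->
  partialC a (fun y => h (f y)) x =
  \sum_b real_complex R ('J f x a b) * partialC b h (f x).
Proof.
move=> df [h1 h2]; rewrite /partialC.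
rewrite (derive_chain _ df h1) (derive_chain _ df h2).
have J b : 'D_(delta_mx 0 a) f x 0 b = 'J f x a b.
  by rewrite deriveEjacobian// -rowE mxE.
under eq_bigr do rewrite J.
under [X in Complex _ X]eq_bigr do rewrite J.
elim/big_rec3: _ => [//|b y1 y2 y3 _ <-].
apply/eqP; rewrite eq_complex /=; apply/andP; split; apply/eqP; ring.
Qed.

(** * Multilinear functions of the rows of a matrix *)

Section RowReplacement.
Variables (T : comNzRingType) (k n : nat).
Implicit Types (V : 'M[T]_(k, n)) (u v : 'rV[T]_n).

Definition set_row (i : 'I_k) u V : 'M[T]_(k, n) :=
  \matrix_j (if j == i then u else row j V).

Lemma row_set_row i u V : row i (set_row i u V) = u.
Proof. by rewrite rowK eqxx. Qed.

Lemma row_set_row_neq i j u V : j != i -> row j (set_row i u V) = row j V.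
Proof. by move=> /negbTE ji; rewrite rowK ji. Qed.

Lemma set_row_id i V : set_row i (row i V) V = V.
Proof. by apply/row_matrixP => j; rewrite rowK; case: eqP => [->|]. Qed.

Lemma set_row_mul m i u V (Q : 'M[T]_(n, m)) :
  \matrix_j (if j == i then u *m Q else row j (V *m Q)) = set_row i u V *m Q.
Proof. by apply/row_matrixP => j; rewrite row_mul !rowK; case: eqP => //;
  rewrite row_mul. Qed.

Lemma eq_row'P i V V' : row' i V = row' i V' <-> forall j, j != i -> row j V = row j V'.
Proof.
split=> [E j|E].
  rewrite eq_sym => /unlift_some[j' -> _].
  by apply/rowP => a; move/matrixP/(_ j' a): E; rewrite !mxE.
apply/matrixP => j a; have : lift i j != i by rewrite eq_sym neq_lift.
by move=> /E/rowP/(_ a); rewrite !mxE.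
Qed.

End RowReplacement.

Section Multilinear.
Variables (R : realType) (k n : nat).
Local Notation C := R[i].
Implicit Types (f : 'M[C]_(k, n) -> C) (V : 'M[C]_(k, n)).

Lemma multilinearP f : multilinear f <->
  forall i (a b : C) u v V,
    f (set_row i (a *: u + b *: v) V) = a * f (set_row i u V) + b * f (set_row i v V).
Proof.
split=> [fl i a b u v V|fl V V1 V2 i a b E E1 E2].
  apply: (fl _ _ _ i); rewrite ?row_set_row//;
    by apply/eq_row'P => j ji; rewrite !row_set_row_neq.
have -> : V1 = set_row i (row i V1) V.
  by apply/row_matrixP => j; rewrite rowK; case: eqP => [->//|/eqP];
    move/eq_row'P: E1; exact.
have -> : V2 = set_row i (row i V2) V.
  by apply/row_matrixP => j; rewrite rowK; case: eqP => [->//|/eqP];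
    move/eq_row'P: E2; exact.
by rewrite -fl -E set_row_id.
Qed.

Lemma multilinear0 f i V : multilinear f -> f (set_row i 0 V) = 0.
Proof.
move=> /multilinearP/(_ i 0 0 0 0 V).
by rewrite !scale0r addr0 !mul0r addr0.
Qed.

Lemma multilinear_row0 f i V : multilinear f -> row i V = 0 -> f V = 0.
Proof. by move=> fl Vi; rewrite -(set_row_id i V) Vi multilinear0. Qed.

Lemma multilinearD f i u v V : multilinear f ->
  f (set_row i (u + v) V) = f (set_row i u V) + f (set_row i v V).
Proof. by move=> /multilinearP/(_ i 1 1 u v V); rewrite !scale1r !mul1r. Qed.

Lemma multilinearZ f i (a : C) u V : multilinear f ->
  f (set_row i (a *: u) V) = a * f (set_row i u V).
Proof. by move=> /multilinearP/(_ i a 0 u 0 V); rewrite scale0r mul0r !addr0. Qed.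

Lemma multilinear_sum f i (I : Type) (r : seq I) (P : pred I) (c : I -> C) u V :
  multilinear f ->
  f (set_row i (\sum_(l <- r | P l) c l *: u l) V) =
  \sum_(l <- r | P l) c l * f (set_row i (u l) V).
Proof.
move=> fl; elim/big_rec2: _ => [|l y1 y2 _ <-]; first exact: multilinear0.
by rewrite multilinearD// multilinearZ.
Qed.

Lemma multilinear_delta f i V : multilinear f ->
  f V = \sum_l V i l * f (set_row i (delta_mx 0 l) V).
Proof.
move=> fl; rewrite -{1}(set_row_id i V) {1}(row_sum_delta (row i V)) multilinear_sum//.
by apply: eq_bigr => l _; rewrite mxE.
Qed.

(** Induction on the number of leading rows that may be outside G: such a row
    is split into two rows in G. *)
Lemma multilinear_span f (G : 'rV[C]_n -> Prop) : multilinear f ->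
  (forall v, exists a b u1 u2, [/\ G u1, G u2 & v = a *: u1 + b *: u2]) ->
  (forall V, (forall i, G (row i V)) -> f V = 0) -> forall V, f V = 0.
Proof.
move=> fl span f0 V.
have aux m : forall V, (forall i : 'I_k, (m <= i)%N -> G (row i V)) -> f V = 0.
  elim: m => [|m IH] {}V GV; first by apply: f0 => i; exact: GV.
  have [km|mk] := leqP k m.
    by apply: IH => i mi; have := leq_ltn_trans (leq_trans km mi) (ltn_ord i);
      rewrite ltnn.
  pose i := Ordinal mk; rewrite -(set_row_id i V).
  have [a [b [u1 [u2 [G1 G2 ->]]]]] := span (row i V).
  have IH' u : G u -> f (set_row i u V) = 0.
    move=> Gu; apply: IH => j mj; rewrite rowK; case: eqP => // /eqP ji.
    by apply: GV; rewrite ltn_neqAle mj andbT; apply: contra ji => /eqP mj';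
      apply/eqP/val_inj.
  by rewrite multilinearD// !multilinearZ// !IH'// !mulr0 addr0.
by apply: (aux k) => i; rewrite leqNgt ltn_ord.
Qed.

Lemma multilinear_mul (Q : 'M[C]_n) f :
  multilinear f -> multilinear (fun V => f (V *m Q)).
Proof.
move=> fl; apply/multilinearP => i a b u v V.
rewrite -!set_row_mul mulmxDl -!scalemxAl -!/(set_row _ _ _).
by rewrite multilinearD// !multilinearZ.
Qed.

Lemma alternating_mul (Q : 'M[C]_n) f :
  Defs.alternating f -> Defs.alternating (fun V => f (V *m Q)).
Proof. by move=> fa V i1 i2 i12 E; apply: (fa _ _ _ i12); rewrite !row_mul E. Qed.

Lemma multilinear_lin f g (a b : C) : multilinear f -> multilinear g ->
  multilinear (fun V => a * f V + b * g V).
Proof.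
move=> fl gl; apply/multilinearP => i c d u v V.
rewrite !multilinearD// !multilinearZ//; ring.
Qed.

Lemma multilinear_conj f :
  multilinear f -> multilinear (fun V => conjc (f (map_mx conjc V))).
Proof.
move=> fl; apply/multilinearP => i a b u v V.
have E w : map_mx conjc (set_row i w V) = set_row i (map_mx conjc w) (map_mx conjc V).
  by apply/row_matrixP => j; rewrite -map_row !rowK; case: eqP => //; rewrite map_row.
rewrite !E map_mxD !map_mxZ multilinearD// !multilinearZ//.
by rewrite rmorphD !rmorphM /= !conjcK.
Qed.

End Multilinear.

Section MultilinearFields.
Variables (R : realType) (k n : nat) (U : set 'rV[R]_n) (Uo : open U).
Local Notation C := R[i].
Variable w : 'rV[R]_n -> 'M[C]_(k, n) -> C.
Hypothesis w_multilinear : forall x, U x -> multilinear (w x).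
Hypothesis w_smooth : forall V, smoothC U (w^~ V).

(** Induction on the number of leading rows of B that may vary: expanding such
    a row in the canonical basis replaces it by constant rows with smooth
    coefficients. *)
Lemma smoothC_multilinear (B : 'rV[R]_n -> 'M[C]_(k, n)) :
  (forall i l, smoothC U (fun x => B x i l)) -> smoothC U (fun x => w x (B x)).
Proof.
move=> sB.
have aux m : forall B : 'rV[R]_n -> 'M[C]_(k, n),
    (forall i l, smoothC U (fun x => B x i l)) ->
    (forall (i : 'I_k) x y, (m <= i)%N -> row i (B x) = row i (B y)) ->
    smoothC U (fun x => w x (B x)).
  elim: m => [|m IH] {sB}B sB cB.
    apply: (smoothC_ext Uo _ (w_smooth (B 0))) => x _; congr (w x _).
    by apply/row_matrixP => i; exact: cB.
  have [km|mk] := leqP k m.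
    apply: IH => // i x y mi.
    by have := leq_ltn_trans (leq_trans km mi) (ltn_ord i); rewrite ltnn.
  pose i := Ordinal mk.
  apply: (smoothC_ext (f := fun x => \sum_l B x i l *
    w x (set_row i (delta_mx 0 l) (B x)))) => //.
    by move=> x Ux; rewrite -multilinear_delta//; exact: w_multilinear.
  apply: smoothC_sum => // l; apply: smoothCM => //; apply: IH => [j a|j x y mj].
    case: (eqVneq j i) => ji.
      apply: (smoothC_ext Uo _ (smoothC_cst U (delta_mx 0 l 0 a))) => x _.
      by rewrite [RHS]mxE ji eqxx.
    by apply: (smoothC_ext Uo _ (sB j a)) => x _; rewrite [RHS]mxE (negbTE ji) mxE.
  rewrite !rowK; case: eqP => // /eqP ji.
  by apply: cB; rewrite ltn_neqAle mj andbT; apply: contra ji => /eqP mj';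
    apply/eqP/val_inj.
by apply: (aux k) => // i x y; rewrite leqNgt ltn_ord.
Qed.

End MultilinearFields.

(** * Derivatives along complexified vectors *)

Section DirectionalDerivative.
Variables (R : realType) (n : nat).
Local Notation C := R[i].
Implicit Types (U : set 'rV[R]_n) (f g : 'rV[R]_n -> C) (x : 'rV[R]_n) (u v : 'rV[C]_n).

Lemma differentiableC_sum (I : Type) (r : seq I) (P : pred I) (F : I -> 'rV[R]_n ->
  C) x :
  (forall i, differentiableC (F i) x) ->
  differentiableC (fun y => \sum_(i <- r | P i) F i y) x.
Proof.
move=> dF; elim: r => [|i r IH].
  rewrite (_ : (fun _ => _) = fun=> 0); first exact: differentiableC_cst.
  by apply/funext => y; rewrite big_nil.
case Pi : (P i).
  rewrite (_ : (fun _ => _) = fun y => F i y + \sum_(i <- r | P i) F i y).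
    exact: differentiableCD.
  by apply/funext => y; rewrite big_cons Pi.
rewrite (_ : (fun _ => _) = fun y => \sum_(i <- r | P i) F i y)//.
by apply/funext => y; rewrite big_cons Pi.
Qed.

Lemma partialC_sum (I : Type) (r : seq I) (P : pred I) (F : I -> 'rV[R]_n -> C) a x :
  (forall i, differentiableC (F i) x) ->
  partialC a (fun y => \sum_(i <- r | P i) F i y) x =
    \sum_(i <- r | P i) partialC a (F i) x.
Proof.
move=> dF; elim: r => [|i r IH].
  rewrite (_ : (fun _ => _) = fun=> 0) ?partialC_cst ?big_nil//.
  by apply/funext => y; rewrite big_nil.
rewrite big_cons; case Pi : (P i).
  rewrite (_ : (fun _ => _) = fun y => F i y + \sum_(i <- r | P i) F i y).
    by rewrite partialCD ?IH//; exact: differentiableC_sum.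
  by apply/funext => y; rewrite big_cons Pi.
rewrite -IH; congr (partialC _ _ _).
by apply/funext => y; rewrite big_cons Pi.
Qed.

Lemma partialCZ a z f x : differentiableC f x ->
  partialC a (fun y => z * f y) x = z * partialC a f x.
Proof.
move=> df; rewrite (partialCM a (differentiableC_cst z x) df).
by rewrite partialC_cst mul0r add0r.
Qed.

(** Extension by C-linearity of the derivative along a real vector. *)
Definition derC v f x : C := \sum_a v 0 a * partialC a f x.

Lemma derC_ext U v f g x : open U -> U x -> (forall y, U y -> f y = g y) ->
  derC v f x = derC v g x.
Proof.
by move=> Uo Ux fg; apply: eq_bigr => a _; rewrite (partialC_ext a Uo Ux fg).
Qed.

Lemma derCD v f g x : differentiableC f x -> differentiableC g x ->
  derC v (fun y => f y + g y) x = derC v f x + derC v g x.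
Proof.
move=> df dg; rewrite -big_split/=; apply: eq_bigr => a _.
by rewrite partialCD// mulrDr.
Qed.

Lemma derCZ v z f x : differentiableC f x ->
  derC v (fun y => z * f y) x = z * derC v f x.
Proof.
move=> df; rewrite mulr_sumr; apply: eq_bigr => a _.
by rewrite partialCZ// mulrCA.
Qed.

Lemma derC_sum (I : Type) (r : seq I) (P : pred I) (F : I -> 'rV[R]_n -> C) v x :
  (forall i, differentiableC (F i) x) ->
  derC v (fun y => \sum_(i <- r | P i) F i y) x = \sum_(i <- r | P i) derC v (F i) x.
Proof.
move=> dF; rewrite /derC exchange_big /=; apply: eq_bigr => a _.
by rewrite partialC_sum// mulr_sumr.
Qed.

Lemma derCM v f g x : differentiableC f x -> differentiableC g x ->
  derC v (fun y => f y * g y) x = derC v f x * g x + f x * derC v g x.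
Proof.
move=> df dg; rewrite mulr_suml mulr_sumr -big_split/=; apply: eq_bigr => a _.
by rewrite partialCM//; ring.
Qed.

Lemma derC_conj v f x : differentiableC f x ->
  derC v (fun y => conjc (f y)) x = conjc (derC (map_mx conjc v) f x).
Proof.
move=> df; rewrite rmorph_sum; apply: eq_bigr => a _.
by rewrite partialC_conj// rmorphM /= mxE conjcK.
Qed.

Lemma derC_lin (a b : C) u v f x :
  derC (a *: u + b *: v) f x = a * derC u f x + b * derC v f x.
Proof.
rewrite !mulr_sumr -big_split/=; apply: eq_bigr => c _.
by rewrite !mxE; ring.
Qed.

Lemma smoothC_derC U v f : open U -> smoothC U f -> smoothC U (derC v f).
Proof.
move=> Uo sf; apply: smoothC_sum => // a; apply: smoothCM => //.
  exact: smoothC_cst.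
exact: smoothC_partial.
Qed.

Lemma derC_comm U u v f x : open U -> smoothC U f -> U x ->
  derC u (derC v f) x = derC v (derC u f) x.
Proof.
move=> Uo sf Ux.
have dp b : differentiableC (partialC b f) x.
  exact: smoothC_differentiable (smoothC_partial b sf) Ux.
have E u' v' : derC u' (derC v' f) x =
    \sum_a \sum_b u' 0 a * (v' 0 b * partialC a (partialC b f) x).
  apply: eq_bigr => a _; rewrite -mulr_sumr; congr (_ * _).
  rewrite partialC_sum => [|b].
    by apply: eq_bigr => b _; rewrite partialCZ.
  by apply: differentiableCM => //; exact: differentiableC_cst.
rewrite !E exchange_big/=; apply: eq_bigr => a _; apply: eq_bigr => b _.
by rewrite (partialC_comm _ _ Uo sf Ux) mulrCA.
Qed.

End DirectionalDerivative.

Section RowDerivative.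
Variables (R : realType) (k n : nat) (U : set 'rV[R]_n) (Uo : open U).
Local Notation C := R[i].
Variable w : 'rV[R]_n -> 'M[C]_(k, n) -> C.
Hypothesis w_multilinear : forall x, U x -> multilinear (w x).
Hypothesis w_smooth : forall V, smoothC U (w^~ V).

(** The moving row is expanded in the canonical basis, which reduces this to
    the product rule for its coordinates. *)
Lemma derC_set_row z i (u : 'rV[R]_n -> 'rV[C]_n) V x : U x ->
  (forall l, differentiableC (fun y => u y 0 l) x) ->
  derC z (fun y => w y (set_row i (u y) V)) x =
  derC z (fun y => w y (set_row i (u x) V)) x +
  w x (set_row i (\row_l derC z (fun y => u y 0 l) x) V).
Proof.
move=> Ux du.
have dw l : differentiableC (fun y => w y (set_row i (delta_mx 0 l) V)) x.
  exact: smoothC_differentiable (w_smooth _) Ux.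
have E y v : U y -> w y (set_row i v V) = \sum_l v 0 l *
  w y (set_row i (delta_mx 0 l) V).
  by move=> Uy; rewrite {1}(row_sum_delta v) multilinear_sum//; exact: w_multilinear.
rewrite (derC_ext _ Uo Ux (fun y Uy => E y (u y) Uy)).
rewrite (derC_ext _ Uo Ux (fun y Uy => E y (u x) Uy)) E//.
rewrite derC_sum => [|l]; last exact: differentiableCM.
rewrite derC_sum => [|l]; last by apply: differentiableCM => //;
  exact: differentiableC_cst.
rewrite -big_split/=; apply: eq_bigr => l _.
by rewrite derCM// derCZ// mxE addrC.
Qed.

End RowDerivative.

(** * Operations on differential forms *)

Lemma conj_toC (R : realType) m n (B : 'M[R]_(m, n)) :
  map_mx conjc (map_mx (real_complex R) B) = map_mx (real_complex R) B.
Proof. by apply/matrixP => i j; rewrite !mxE conjc_real. Qed.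

Section Forms.
Variables (R : realType) (n : nat) (M : topologicalType) (A : atlas R n M).
Local Notation C := R[i].
Local Notation toC := (map_mx (real_complex R)).
Local Notation preform := (preform A).

Lemma open_chart_img (c : chart A) : open (chart_img c).
Proof. exact: chart_img_open. Qed.
Hint Resolve open_chart_img : core.

(** The overlap is the part of the open set [chart_img c] that the continuous
    map [of_coord c] sends into the open domain of d. *)
Lemma overlap_open (c d : chart A) : open (overlap c d).
Proof.
rewrite openE => x [m [cm dm] <-].
have xc : chart_img c (to_coord c m) by exists m.
have nc : nbhs (to_coord c m) (chart_img c).
  by apply: open_nbhs_nbhs; split.
have nd : nbhs (to_coord c m) (of_coord c @^-1` chart_dom d).
  apply: of_coord_continuous => //; apply: open_nbhs_nbhs; split.
    exact: chart_dom_open.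
  by rewrite to_coordK.
apply: filterS (filterI nc nd) => y [[m' cm' <-]] /=.
by rewrite to_coordK// => dm'; exists m'.
Qed.
Hint Resolve overlap_open : core.

Lemma overlap_chart_img (c d : chart A) x : overlap c d x -> chart_img c x.
Proof. by move=> [m [cm dm] <-]; exists m. Qed.

Lemma overlap_transition (c d : chart A) x : overlap c d x ->
  chart_img d (transition c d x).
Proof. by move=> [m [cm dm] <-]; rewrite /transition/= to_coordK//; exists m. Qed.

Lemma form_eq_sym k (w w' : preform k) : form_eq w w' -> form_eq w' w.
Proof. by move=> E c x V cx; rewrite E. Qed.

Lemma form_eq_trans k (w1 w2 w3 : preform k) :
  form_eq w1 w2 -> form_eq w2 w3 -> form_eq w1 w3.
Proof. by move=> E E' c x V cx; rewrite E// E'. Qed.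

Lemma is_form_smooth k (w : preform k) c V :
  is_form w -> smoothC (chart_img c) (fun x => w c x V).
Proof. by case=> _ /(_ c V) + _; exact. Qed.

Lemma is_form_differentiable k (w : preform k) c V x :
  is_form w -> chart_img c x -> differentiableC (fun x => w c x V) x.
Proof. by move=> wf cx; exact: smoothC_differentiable (is_form_smooth c V wf) cx. Qed.

Lemma is_form_multilinear k (w : preform k) c x :
  is_form w -> chart_img c x -> multilinear (w c x).
Proof. by move=> [+ _ _] cx => /(_ c x cx)[]. Qed.

Lemma is_form_alternating k (w : preform k) c x :
  is_form w -> chart_img c x -> Defs.alternating (w c x).
Proof. by move=> [+ _ _] cx => /(_ c x cx)[]. Qed.

Lemma is_form_ext k (w w' : preform k) : form_eq w w' -> is_form w -> is_form w'.
Proof.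
move=> E [w1 w2 w3]; split.
- move=> c x cx; have [ml al] := w1 c x cx.
  have <- : w c x = w' c x by apply/funext => V; exact: E.
  by [].
- move=> c V; apply: (@smoothC_ext _ _ _ (fun x => w c x V)) => //.
    by move=> x cx; exact: E.
- move=> c d x V o; rewrite -E; last exact: overlap_chart_img o.
  by rewrite -E; [exact: w3|exact: overlap_transition].
Qed.

Lemma is_form_lin k (w w' : preform k) (a b : C) : is_form w -> is_form w' ->
  is_form (fun c x V => a * w c x V + b * w' c x V).
Proof.
move=> wf wf'; split.
- move=> c x cx; split.
    by apply: multilinear_lin; exact: is_form_multilinear.
  by move=> V i j ij E; rewrite !(is_form_alternating _ cx ij E)// !mulr0 addr0.
- move=> c V; apply: smoothCD => //; apply: smoothCM => //;
    by [exact: smoothC_cst|exact: is_form_smooth].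
- move=> c d x V o; case: wf wf' => _ _ w3 [_ _ w3'].
  by rewrite (w3 _ _ _ _ o) (w3' _ _ _ _ o).
Qed.

Lemma is_formD k (w w' : preform k) : is_form w -> is_form w' -> is_form (w + w').
Proof.
move=> wf wf'; apply: is_form_ext (is_form_lin 1 1 wf wf') => c x V _.
by rewrite /= !fctE !mul1r.
Qed.

Lemma is_formB k (w w' : preform k) : is_form w -> is_form w' -> is_form (w - w').
Proof.
move=> wf wf'; apply: is_form_ext (is_form_lin 1 (-1) wf wf') => c x V _.
by rewrite /= !fctE mul1r mulN1r.
Qed.

Lemma is_form0 k : is_form (0 : preform k).
Proof.
split; last by [].
- move=> c x _; split; last by [].
  by apply/multilinearP => i a b u v V; rewrite [RHS](_ :
    _ = a * 0 + b * 0)// !mulr0 addr0.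
- by move=> c V; exact: (smoothC_cst (chart_img c) (0 : C)).
Qed.

Lemma is_form_conj k (w : preform k) : is_form w -> is_form (conj_form w).
Proof.
move=> wf; split.
- move=> c x cx; split; first exact/multilinear_conj/is_form_multilinear.
  move=> V i j ij E; rewrite /conj_form (is_form_alternating wf cx ij) ?conjc0//.
  by rewrite -!map_row E.
- by move=> c V; apply: smoothC_conj => //; exact: is_form_smooth.
- move=> c d x V o; case: (wf) => _ _ w3.
  rewrite /conj_form (w3 _ _ _ _ o) map_mxM; congr (conjc (w d _ (_ *m _))).
  exact/esym/conj_toC.
Qed.

Lemma is_form_mul k (Q : chart A -> 'rV[R]_n -> 'M[C]_n) (w : preform k) :
  (forall c i l, smoothC (chart_img c) (fun x => Q c x i l)) ->
  (forall c d x, overlap c d x ->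
     Q c x *m toC ('J (transition c d) x) =
     toC ('J (transition c d) x) *m Q d (transition c d x)) ->
  is_form w -> is_form (fun c x V => w c x (V *m Q c x)).
Proof.
move=> sQ cQ wf; split.
- move=> c x cx; split.
    by apply: multilinear_mul; exact: is_form_multilinear.
  by apply: alternating_mul; exact: is_form_alternating.
- move=> c V; apply: smoothC_multilinear => //.
  + by move=> x cx; exact: is_form_multilinear.
  + by move=> V'; exact: is_form_smooth.
  move=> i l; apply: (@smoothC_ext _ _ _ (fun x => \sum_j V i j * Q c x j l)) => //.
    by move=> x _; rewrite mxE.
  apply: smoothC_sum => // j; apply: smoothCM => //; exact: smoothC_cst.
- move=> c d x V o; case: wf => _ _ w3.
  by rewrite (w3 _ _ _ _ o) -!mulmxA cQ.
Qed.

Lemma ext_dE k (w : preform k) c x V :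
  ext_d w c x V = \sum_(j < k.+1) (-1) ^+ j *
    derC (row j V) (fun y => w c y (row' j V)) x.
Proof.
by apply: eq_bigr => j _; congr (_ * _); apply: eq_bigr => a _; rewrite mxE.
Qed.

Lemma ext_d_ext k (w w' : preform k) : form_eq w w' -> form_eq (ext_d w) (ext_d w').
Proof.
move=> E c x V cx; rewrite !ext_dE; apply: eq_bigr => j _; congr (_ * _).
by apply: derC_ext cx _ => // y cy; exact: E.
Qed.

Lemma ext_d_lin k (w w' : preform k) (a b : C) : is_form w -> is_form w' ->
  form_eq (ext_d (fun c x V => a * w c x V + b * w' c x V))
    (fun c x V => a * ext_d w c x V + b * ext_d w' c x V).
Proof.
move=> wf wf' c x V cx; rewrite !ext_dE !mulr_sumr -big_split/=.
apply: eq_bigr => j _.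
have d1 := is_form_differentiable (row' j V) wf cx.
have d2 := is_form_differentiable (row' j V) wf' cx.
rewrite derCD; [|by apply: differentiableCM => //; exact: differentiableC_cst..].
by rewrite !derCZ//; ring.
Qed.

Lemma ext_dD k (w w' : preform k) : is_form w -> is_form w' ->
  form_eq (ext_d (w + w')) (ext_d w + ext_d w').
Proof.
move=> wf wf'; apply: form_eq_trans (form_eq_trans (ext_d_lin 1 1 wf wf') _).
  by apply: ext_d_ext => c x V _; rewrite /= !fctE !mul1r.
by move=> c x V _; rewrite /= !fctE !mul1r.
Qed.

Lemma ext_dB k (w w' : preform k) : is_form w -> is_form w' ->
  form_eq (ext_d (w - w')) (ext_d w - ext_d w').
Proof.
move=> wf wf'; apply: form_eq_trans (form_eq_trans (ext_d_lin 1 (-1) wf wf') _).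
  by apply: ext_d_ext => c x V _; rewrite /= !fctE mul1r mulN1r.
by move=> c x V _; rewrite /= !fctE mul1r mulN1r.
Qed.

Lemma ext_d0 k : form_eq (ext_d (0 : preform k)) 0.
Proof.
move=> c x V cx; rewrite ext_dE big1// => j _.
by rewrite /derC big1 ?mulr0// => a _; rewrite partialC_cst mulr0.
Qed.

Lemma ext_d_conj k (w : preform k) : is_form w ->
  form_eq (ext_d (conj_form w)) (conj_form (ext_d w)).
Proof.
move=> wf c x V cx; rewrite /conj_form !ext_dE rmorph_sum; apply: eq_bigr => j _.
rewrite rmorphM rmorph_sign; congr (_ * _).
rewrite derC_conj; last first.
  exact: is_form_differentiable.
rewrite map_row (_ : map_mx conjc (row' j V) = row' j (map_mx conjc V))//.
by apply/matrixP => a b; rewrite !mxE.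
Qed.

(** In the j-th term, row i is the direction of differentiation if i = j, and
    a row of the argument of w otherwise. *)
Lemma ext_d_multilinear k (w : preform k) c x : is_form w -> chart_img c x ->
  multilinear (ext_d w c x).
Proof.
move=> wf cx; apply/multilinearP => i a b u v V.
rewrite !ext_dE !mulr_sumr -big_split/=; apply: eq_bigr => j _.
rewrite mulrCA [in X in _ = _ + X]mulrCA -mulrDr; congr (_ * _).
have [<-|ij] := eqVneq i j.
  rewrite !row_set_row derC_lin.
  have E z : row' i (set_row i z V) = row' i V.
    by apply/eq_row'P => l li; rewrite row_set_row_neq.
  by rewrite !E.
rewrite !row_set_row_neq 1?eq_sym//.
have ji : j != i by rewrite eq_sym.
have [i' Ei _] := unlift_some ji.
have E z : row' j (set_row i z V) = set_row i' z (row' j V).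
  apply/matrixP => l m; rewrite !mxE Ei (inj_eq (@lift_inj _ j)).
  by case: eqP => // _; rewrite !mxE.
rewrite !E -derCZ; last exact: is_form_differentiable.
rewrite -derCZ; last exact: is_form_differentiable.
rewrite -derCD; last first.
- by apply: differentiableCM; [exact: differentiableC_cst|exact:
    is_form_differentiable].
- by apply: differentiableCM; [exact: differentiableC_cst|exact:
    is_form_differentiable].
apply: derC_ext cx _ => // y cy.
by have wy := is_form_multilinear wf cy; rewrite multilinearD// !multilinearZ.
Qed.

End Forms.

Arguments overlap_open {R n M A} c d.
Arguments open_chart_img {R n M A} c.

(** * The exterior derivative in degrees one and two *)

Lemma ord2P (j : 'I_2) : j != ord0 -> j = ord_max.
Proof. by case: j => -[|[|//]] p // _; apply: val_inj. Qed.

Lemma ord3P (j : 'I_3) : j != ord0 -> j != ord_max -> j = lift ord0 ord0.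
Proof. by case: j => -[|[|[|//]]] p // _ _; apply: val_inj. Qed.

Lemma set_row1 (T : comNzRingType) n (u V : 'rV[T]_n) : set_row ord0 u V = u.
Proof. by apply/rowP => a; rewrite mxE eqxx. Qed.

Section LowDegree.
Variables (R : realType) (n : nat) (M : topologicalType) (A : atlas R n M).
Local Notation C := R[i].
Local Notation toC := (map_mx (real_complex R)).
Local Notation preform := (preform A).

Hint Resolve open_chart_img overlap_open : core.

Definition rows2 (u v : 'rV[C]_n) : 'M[C]_(2, n) :=
  \matrix_j (if j == ord0 then u else v).

Lemma rows2E (V : 'M[C]_(2, n)) : V = rows2 (row ord0 V) (row ord_max V).
Proof.
by apply/row_matrixP => j; rewrite rowK; case: eqVneq => [->|/ord2P ->].
Qed.

Lemma row_rows2l u v : row ord0 (rows2 u v) = u.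
Proof. by rewrite rowK. Qed.

Lemma row_rows2r u v : row ord_max (rows2 u v) = v.
Proof. by rewrite rowK. Qed.

Lemma ext_d1E (g : preform 1) c x u v :
  ext_d g c x (rows2 u v) =
  derC u (fun y => g c y v) x - derC v (fun y => g c y u) x.
Proof.
rewrite ext_dE !big_ord_recl big_ord0 /= expr0 mul1r expr1 mulN1r addr0.
have E1 : row' ord0 (rows2 u v) = v.
  by apply/rowP => a; rewrite !mxE.
have E2 : row' (lift ord0 ord0) (rows2 u v) = u.
  by apply/matrixP => i a; rewrite !mxE !ord1.
by rewrite E1 E2 !rowK.
Qed.

Definition rows3 (u v z : 'rV[C]_n) : 'M[C]_(3, n) :=
  \matrix_j (if j == ord0 then u else if j == ord_max then z else v).

Lemma rows3E (V : 'M[C]_(3, n)) :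
  V = rows3 (row ord0 V) (row (lift ord0 ord0) V) (row ord_max V).
Proof.
apply/row_matrixP => j; rewrite rowK; case: eqVneq => [->//|j0].
by case: eqVneq => [->//|jm]; rewrite [in LHS](ord3P j0 jm).
Qed.

Lemma ext_d2E (w : preform 2) c x u v z :
  ext_d w c x (rows3 u v z) =
  derC u (fun y => w c y (rows2 v z)) x - derC v (fun y => w c y (rows2 u z)) x
  + derC z (fun y => w c y (rows2 u v)) x.
Proof.
rewrite ext_dE !big_ord_recl big_ord0 /= expr0 mul1r expr1 mulN1r sqrrN expr1n mul1r
  addr0 addrA.
have E1 : row' ord0 (rows3 u v z) = rows2 v z.
  by apply/row_matrixP => -[[|[|//]] i]; apply/rowP => a; rewrite !mxE.
have E2 : row' (lift ord0 ord0) (rows3 u v z) = rows2 u z.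
  by apply/row_matrixP => -[[|[|//]] i]; apply/rowP => a; rewrite !mxE.
have E3 : row' (lift ord0 (lift ord0 ord0)) (rows3 u v z) = rows2 u v.
  by apply/row_matrixP => -[[|[|//]] i]; apply/rowP => a; rewrite !mxE.
by rewrite E1 E2 E3 !rowK.
Qed.

(** The transformation rule in coordinates: as a function of the point, each
    summand is a product of functions whose derivatives are known. *)
Lemma form1_pullback (g : preform 1) c d x v : is_form g -> overlap c d x ->
  g c x v = \sum_b (\sum_l v 0 l * toC ('J (transition c d) x) l b) *
              g d (transition c d x) (delta_mx 0 b).
Proof.
move=> gf o; have [_ _ /(_ c d x v o) ->] := gf.
rewrite (multilinear_delta ord0); last first.
  exact: is_form_multilinear (overlap_transition o).
apply: eq_bigr => b _; congr (_ * g d _ _); first by rewrite mxE.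
exact: set_row1.
Qed.

(** The Jacobian as a first derivative, to which the symmetry of second
    derivatives applies. *)
Lemma jacobianE c d l b x : overlap c d x ->
  toC ('J (@transition R n M A c d) x) l b =
  partialC l (fun y => real_complex R (transition c d y 0 b)) x.
Proof.
move=> o.
have df : differentiable (transition c d) x.
  exact: smooth_on_differentiable (@transition_smooth _ _ _ A c d) o.
rewrite mxE /partialC /= derive_cst.
have dv : derivable (transition c d) x (delta_mx 0 l) by exact: diff_derivable.
have := derive_mx dv.
move=> /(congr1 (fun B : 'rV[R]_n => B 0 b)); rewrite mxE => <-.
by rewrite deriveEjacobian// -rowE !mxE.
Qed.

Lemma smoothC_transition c d b :
  smoothC (overlap c d) (fun x => real_complex R (@transition R n M A c d x 0 b)).
Proof.
apply: smoothC_real.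
exact: smooth_on_entry 0 b (overlap_open c d) (@transition_smooth _ _ _ A c d).
Qed.

Lemma smoothC_jacobian c d l b :
  smoothC (overlap c d) (fun x => toC ('J (@transition R n M A c d) x) l b).
Proof.
apply: (smoothC_ext _ _ (smoothC_partial l (smoothC_transition c d b))) => // x o.
by rewrite jacobianE.
Qed.

Lemma derC_transition (h : 'rV[R]_n -> C) c d u x : overlap c d x ->
  differentiableC h (transition c d x) ->
  derC u (fun y => h (transition c d y)) x =
  derC (u *m toC ('J (@transition R n M A c d) x)) h (transition c d x).
Proof.
move=> o dh.
have df : differentiable (transition c d) x.
  exact: smooth_on_differentiable (@transition_smooth _ _ _ A c d) o.
rewrite /derC; under eq_bigr do rewrite (partialC_chain _ df dh) mulr_sumr.
rewrite exchange_big/=; apply: eq_bigr => b _; rewrite mxE mulr_suml.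
by apply: eq_bigr => a _; rewrite mulrA; congr (_ * _ * _); rewrite [RHS]mxE.
Qed.

(** Differentiating the transformation rule of g gives the expected term plus a
    term in the second derivatives of the transition map, which is symmetric in
    the two arguments and cancels in the alternating sum. *)
Lemma ext_d1_transition (g : preform 1) c d x V : is_form g -> overlap c d x ->
  ext_d g c x V = ext_d g d (transition c d x) (V *m toC ('J (transition c d) x)).
Proof.
move=> gf o; have cx := overlap_chart_img o.
set phi := transition c d; set J := fun y => toC ('J phi y);
  rewrite -[X in V *m X]/(J x).
rewrite (rows2E V); move: (row ord0 V) (row ord_max V) => u v.
have -> : rows2 u v *m J x = rows2 (u *m J x) (v *m J x).
  by apply/row_matrixP => j; rewrite row_mul !rowK; case: eqP.
rewrite !ext_d1E.
pose e (b : 'I_n) : 'rV[C]_n := delta_mx 0 b.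
have dJ l b : differentiableC (fun y => J y l b) x.
  exact: smoothC_differentiable (smoothC_jacobian c d l b) o.
have dg b : differentiableC (fun y => g d y (e b)) (phi x).
  by apply: is_form_differentiable => //; exact: overlap_transition.
have dgp b : differentiableC (fun y => g d (phi y) (e b)) x.
  have df : differentiable phi x.
    exact: smooth_on_differentiable (@transition_smooth _ _ _ A c d) o.
  have [d1 d2] := dg b; split.
  - exact: (@differentiable_comp _ _ _ _ phi (fun y => complex.Re (g d y (e b)) : R^o)).
  - exact: (@differentiable_comp _ _ _ _ phi (fun y => complex.Im (g d y (e b)) : R^o)).
have dvJ w b : differentiableC (fun y => \sum_l w 0 l * J y l b) x.
  apply: differentiableC_sum => l; apply: differentiableCM => //;
    exact: differentiableC_cst.
have E w z : derC w (fun y => g c y z) x =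
   \sum_b (\sum_a \sum_l w 0 a * z 0 l * partialC a (fun y =>
     J y l b) x) * g d (phi x) (e b)
   + derC (w *m J x) (fun y => g d y (z *m J x)) (phi x).
  rewrite (derC_ext w (overlap_open c d) o (fun y oy => form1_pullback z gf oy)).
  rewrite derC_sum => [|b]; last exact: differentiableCM.
  have -> : derC (w *m J x) (fun y => g d y (z *m J x)) (phi x) =
      \sum_b (z *m J x) 0 b * derC (w *m J x) (fun y => g d y (e b)) (phi x).
    have od := overlap_transition o.
    rewrite (derC_ext (g := fun y => \sum_b (z *m J x) 0 b *
      g d y (e b)) _ (open_chart_img d) od).
      rewrite derC_sum => [|b].
        by apply: eq_bigr => b _; rewrite derCZ.
      by apply: differentiableCM => //; exact: differentiableC_cst.
    move=> y dy; rewrite (multilinear_delta ord0);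
      last exact: is_form_multilinear gf dy.
    apply: eq_bigr => b _; congr (_ * g d _ _).
    exact: set_row1.
  rewrite -big_split/=; apply: eq_bigr => b _.
  have tr := derC_transition w o (dg b); rewrite -/phi -/(J x) in tr.
  rewrite derCM// tr; congr (_ * _ + _ * _); last by rewrite mxE.
  rewrite /derC; apply: eq_bigr => a _.
  rewrite partialC_sum => [|l]; last by apply: differentiableCM => //;
    exact: differentiableC_cst.
  rewrite mulr_sumr; apply: eq_bigr => l _; rewrite partialCZ// mulrA//.
rewrite !E opprD addrACA.
suff -> : \sum_b (\sum_a \sum_l u 0 a * v 0 l * partialC a (fun y =>
  J y l b) x) * g d (phi x) (e b) =
   \sum_b (\sum_a \sum_l v 0 a * u 0 l * partialC a (fun y =>
     J y l b) x) * g d (phi x) (e b).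
  by rewrite subrr add0r.
apply: eq_bigr => b _; congr (_ * _); rewrite exchange_big /=.
apply: eq_bigr => a _; apply: eq_bigr => l _; rewrite [u 0 l * _]mulrC; congr (_ * _).
rewrite (partialC_ext l (overlap_open c d) o (fun y oy => jacobianE a b oy)).
rewrite (partialC_ext a (overlap_open c d) o (fun y oy => jacobianE l b oy)).
exact: partialC_comm (overlap_open c d) (smoothC_transition c d b) o.
Qed.

Lemma is_form_ext_d1 (g : preform 1) : is_form g -> is_form (ext_d g).
Proof.
move=> gf; split.
- move=> c x cx; split; first exact: ext_d_multilinear.
  move=> V i1 i2 i12 E.
  have E' : row ord0 V = row ord_max V.
    case: i1 i2 i12 E => -[|[|//]] p [] [|[|//]] q // _ E.
      rewrite (_ : ord0 = Ordinal p) ?E; last exact: val_inj.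
      by congr (row _ V); apply: val_inj.
    rewrite (_ : ord0 = Ordinal q) -?E; last exact: val_inj.
    by congr (row _ V); apply: val_inj.
  by rewrite (rows2E V) E' ext_d1E subrr.
- move=> c V; apply: (smoothC_ext (f := fun x => \sum_(j < 2) (-1) ^+ j *
    derC (row j V) (fun y => g c y (row' j V)) x)) => //.
    by move=> x _; rewrite ext_dE.
  apply: smoothC_sum => // j; apply: smoothCM => //; first exact: smoothC_cst.
  by apply: smoothC_derC => //; exact: is_form_smooth.
- by move=> c d x V o; exact: ext_d1_transition.
Qed.

(** The six second derivatives cancel in pairs by symmetry. *)
Lemma ext_d_ext_d1 (g : preform 1) : is_form g -> form_eq (ext_d (ext_d g)) 0.
Proof.
move=> gf c x V cx; rewrite (rows3E V); move: (row ord0 V) (row (lift _ _) V) (row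
  ord_max V) => u v z.
rewrite ext_d2E.
have s t : smoothC (chart_img c) (fun y => g c y t) by exact: is_form_smooth.
have E a b t : derC a (fun y => ext_d g c y (rows2 b t)) x =
    derC a (derC b (fun y => g c y t)) x - derC a (derC t (fun y => g c y b)) x.
  rewrite (_ : (fun y => _) = fun y => derC b (fun y =>
    g c y t) y + (-1) * derC t (fun y => g c y b) y).
    have d1 b' t' : differentiableC (derC b' (fun y => g c y t')) x.
      exact: smoothC_differentiable (smoothC_derC b' (open_chart_img c) (s t')) cx.
    rewrite derCD//; last by apply: differentiableCM => //; exact: differentiableC_cst.
    by rewrite derCZ// mulN1r.
  by apply/funext => y; rewrite ext_d1E mulN1r.
rewrite !E [derC v (derC u _) x](derC_comm _ _ (open_chart_img c) (s _) cx).
rewrite [derC z (derC u _) x](derC_comm _ _ (open_chart_img c) (s _) cx).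
rewrite [derC z (derC v _) x](derC_comm _ _ (open_chart_img c) (s _) cx).
have alg (p q r : C) : p - q - (p - r) + (q - r) = 0 by ring.
exact: alg.
Qed.

Lemma closed_ext_d1 (g : preform 1) : is_form g -> closed_form (ext_d g).
Proof. by move=> gf; split; [exact: is_form_ext_d1|exact: ext_d_ext_d1]. Qed.

Lemma closed_formB k (w w' : Defs.preform A k) :
  closed_form w -> closed_form w' -> closed_form (w - w').
Proof.
move=> [wf dw] [wf' dw']; split; first exact: is_formB.
apply: form_eq_trans (ext_dB wf wf') _ => c x V cx.
by rewrite /= !fctE dw// dw'// subrr.
Qed.

Lemma closed_formD k (w w' : Defs.preform A k) :
  closed_form w -> closed_form w' -> closed_form (w + w').
Proof.
move=> [wf dw] [wf' dw']; split; first exact: is_formD.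
apply: form_eq_trans (ext_dD wf wf') _ => c x V cx.
by rewrite /= !fctE dw// dw'// addr0.
Qed.

Lemma closed_form_conj k (w : Defs.preform A k) : closed_form w ->
  closed_form (conj_form w).
Proof.
move=> [wf dw]; split; first exact: is_form_conj.
apply: form_eq_trans (ext_d_conj wf) _ => c x V cx.
by rewrite /conj_form dw// conjc0.
Qed.

Lemma closed_form0 k : closed_form (0 : Defs.preform A k).
Proof. by split; [exact: is_form0|exact: ext_d0]. Qed.

End LowDegree.

(** * Types of vectors and integrability *)

Section Types.
Variables (R : realType) (n : nat) (M : topologicalType) (A : atlas R n M).
Variable J : almost_complex A.
Local Notation C := R[i].
Local Notation toC := (map_mx (real_complex R)).
Local Notation preform := (preform A).
Local Notation JC c x := (toC (acs J c x)).
Local Notation I := ('i%C : C).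

Hint Resolve open_chart_img overlap_open : core.

Lemma sqrI : I * I = -1.
Proof. by rewrite -expr2 sqr_i. Qed.

Lemma conjI : conjc I = - I.
Proof. by apply/eqP; rewrite eq_complex /= oppr0 !eqxx. Qed.

Definition type10 c x (v : 'rV[C]_n) := v *m JC c x = I *: v.
Definition type01 c x (v : 'rV[C]_n) := v *m JC c x = - I *: v.

Lemma JC_square c x : chart_img c x -> JC c x *m JC c x = - 1%:M.
Proof. by move=> cx; rewrite -map_mxM acs_square// map_mxN map_mx1. Qed.

Lemma proj10E c x (v : 'rV[C]_n) : v *m proj10 J c x = 2^-1 *: (v - I *: (v *m JC c x)).
Proof. by rewrite /proj10 -scalemxAr mulmxBr mulmx1 -scalemxAr. Qed.

Lemma proj01E c x (v : 'rV[C]_n) : v *m proj01 J c x = 2^-1 *: (v + I *: (v *m JC c x)).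
Proof. by rewrite /proj01 -scalemxAr mulmxDr mulmx1 -scalemxAr. Qed.

Lemma proj_sum c x (v : 'rV[C]_n) : v = v *m proj10 J c x + v *m proj01 J c x.
Proof.
rewrite proj10E proj01E -scalerDr addrACA addNr addr0 -mulr2n -[v *+ 2]scaler_nat
  scalerA.
by rewrite mulVf ?scale1r// pnatr_eq0.
Qed.

Lemma type10_proj10 c x v : type10 c x v -> v *m proj10 J c x = v.
Proof.
move=> vJ; rewrite proj10E vJ scalerA sqrI scaleN1r opprK -mulr2n -[v *+ 2]scaler_nat
  scalerA.
by rewrite mulVf ?scale1r// pnatr_eq0.
Qed.

Lemma type10_proj01 c x v : type10 c x v -> v *m proj01 J c x = 0.
Proof. by move=> vJ; rewrite proj01E vJ scalerA sqrI scaleN1r subrr scaler0. Qed.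

Lemma type01_proj10 c x v : type01 c x v -> v *m proj10 J c x = 0.
Proof.
by move=> vJ; rewrite proj10E vJ scalerA mulrN sqrI opprK scale1r subrr scaler0.
Qed.

Lemma type01_proj01 c x v : type01 c x v -> v *m proj01 J c x = v.
Proof. move=> vJ; rewrite proj01E vJ scalerA mulrN sqrI opprK scale1r -mulr2n.
by rewrite -[v *+ 2]scaler_nat scalerA mulVf ?scale1r// pnatr_eq0. Qed.

Lemma proj10_type10 c x v : chart_img c x -> type10 c x (v *m proj10 J c x).
Proof.
move=> cx; rewrite /type10 proj10E -scalemxAl mulmxBl -scalemxAl -mulmxA JC_square//.
rewrite mulmxN mulmx1 scalerN opprK scalerA mulrC -scalerA; congr (_ *: _).
by rewrite scalerBr scalerA sqrI scaleN1r opprK addrC.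
Qed.

Lemma proj01_type01 c x v : chart_img c x -> type01 c x (v *m proj01 J c x).
Proof.
move=> cx; rewrite /type01 proj01E -scalemxAl mulmxDl -scalemxAl -mulmxA JC_square//.
rewrite mulmxN mulmx1 scalerN scalerA mulrC -scalerA; congr (_ *: _).
by rewrite scalerDr scalerA mulNr sqrI opprK scale1r addrC scaleNr.
Qed.

Lemma type10_conj c x v : type10 c x v -> type01 c x (map_mx conjc v).
Proof.
move=> vJ; rewrite /type01 -(conj_toC (acs J c x)) -map_mxM vJ map_mxZ.
by congr (_ *: _); exact: conjI.
Qed.

Lemma type01_conj c x v : type01 c x v -> type10 c x (map_mx conjc v).
Proof.
move=> vJ; rewrite /type10 -(conj_toC (acs J c x)) -map_mxM vJ map_mxZ.
by congr (_ *: _); rewrite rmorphN; apply/eqP; rewrite eqr_oppLR; apply/eqP;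
  exact: conjI.
Qed.

(** A vector is the sum of a vector of type (1,0) and one of type (0,1), so
    tuples of eigenvectors of J span. *)
Lemma pure_eq0 k c x (f : 'M[C]_(k, n) -> C) : chart_img c x -> multilinear f ->
  (forall V (S : {set 'I_k}), 
    (forall j, row j V *m JC c x = (if j \in S then I else - I) *: row j V) ->
      f V = 0) ->
  forall V, f V = 0.
Proof.
move=> cx fl f0; apply: (multilinear_span (G := fun v =>
  type10 c x v \/ type01 c x v)) => //.
  move=> v; exists 1, 1, (v *m proj10 J c x), (v *m proj01 J c x); split.
  - by left; exact: proj10_type10.
  - by right; exact: proj01_type01.
  - by rewrite [LHS](proj_sum c x v); congr (_ + _); rewrite scale1r.
move=> V tV; apply: (f0 V [set j | row j V *m JC c x == I *: row j V]%SET) => j.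
by rewrite inE; case: eqP => // ne; case: (tV j).
Qed.

Lemma smoothC_acs c l m : smoothC (chart_img c) (fun x => JC c x l m).
Proof.
apply: (smoothC_ext (open_chart_img c) _
   (smoothC_real (smooth_on_entry l m (open_chart_img c) (@acs_smooth _ _ _ _ J c)))).
by move=> x _; rewrite mxE.
Qed.

Lemma smoothC_proj10 c l m : smoothC (chart_img c) (fun x => proj10 J c x l m).
Proof.
apply: (smoothC_ext (f := fun x => 2^-1 * ((1%:M :
  'M[C]_n) l m + (- I) * JC c x l m))) => //.
  by move=> x _; rewrite !mxE mulNr.
apply: smoothCM => //; first exact: smoothC_cst.
apply: smoothCD => //; first exact: smoothC_cst.
apply: smoothCM => //; first exact: smoothC_cst.
exact: smoothC_acs.
Qed.

Lemma proj10_compat c d x : overlap c d x ->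
  proj10 J c x *m toC ('J (transition c d) x) =
  toC ('J (transition c d) x) *m proj10 J d (transition c d x).
Proof.
move=> o; rewrite /proj10 -scalemxAl -scalemxAr mulmxBl mulmxBr mul1mx mulmx1.
by rewrite -scalemxAl -scalemxAr -!map_mxM acs_compat.
Qed.

(** The component of bidegree (k,0). *)
Definition part10 k (w : preform k) : preform k := fun c x V =>
  w c x (V *m proj10 J c x).

Lemma is_form_part10 k (w : preform k) : is_form w -> is_form (part10 w).
Proof.
apply: is_form_mul; [exact: smoothC_proj10|exact: proj10_compat].
Qed.

(** Being of bidegree (k,0), phrased with a single vector of type (0,1) so that
    the other arguments are arbitrary. *)
Definition kills01 k (w : preform k) := forall c x V j,
  chart_img c x -> type01 c x (row j V) -> w c x V = 0.

Lemma part10_kills01 k (w : preform k) : is_form w -> kills01 (part10 w).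
Proof.
move=> wf c x V j cx t; rewrite /part10.
rewrite (multilinear_row0 (i := j) (is_form_multilinear wf cx))//.
by rewrite row_mul type01_proj10.
Qed.

Section Integrability.
Hypothesis J_int : integrable_acs J.

Definition derJ c x (z : 'rV[C]_n) : 'M[C]_n :=
  \matrix_(l, m) derC z (fun y => JC c y l m) x.

Lemma derJ_lin c x a b u v : derJ c x (a *: u + b *: v) = a *: derJ c x u +
  b *: derJ c x v.
Proof. by apply/matrixP => l m; rewrite !mxE derC_lin. Qed.

Lemma derJZ c x a u : derJ c x (a *: u) = a *: derJ c x u.
Proof. by have := derJ_lin c x a 0 u 0; rewrite !scale0r !addr0. Qed.

Lemma derJ_real c x (z : 'rV[R]_n) : chart_img c x ->
  derJ c x (toC z) = toC ('D_z (acs J c) x).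
Proof.
move=> cx; have dJ := smooth_on_differentiable (@acs_smooth _ _ _ _ J c) cx.
have dv : derivable (acs J c) x z by exact: diff_derivable.
apply/matrixP => l m; rewrite !mxE derive_mx// mxE.
have dlm : differentiable (fun y => acs J c y l m : R^o) x.
  have s := smooth_on_entry l m (open_chart_img c) (@acs_smooth _ _ _ _ J c).
  exact: smooth_on_differentiable s cx.
rewrite (derive_sum_delta z dlm) rmorph_sum; apply: eq_bigr => a _.
rewrite mxE rmorphM; congr (_ * _); rewrite /partialC.
have -> : (fun y => complex.Re (JC c y l m) : R^o) = fun y => acs J c y l m.
  by apply/funext => y; rewrite mxE.
have -> : (fun y => complex.Im (JC c y l m) : R^o) = fun=> 0.
  by apply/funext => y; rewrite mxE.
by rewrite derive_cst.
Qed.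

(** The Nijenhuis tensor in constant vector fields, whose brackets reduce to
    derivatives of J, extended to complex vectors by bilinearity. *)
Definition nijenhuisC c x (u v : 'rV[C]_n) : 'rV[C]_n :=
  v *m derJ c x (u *m JC c x) - u *m derJ c x (v *m JC c x)
  + u *m derJ c x v *m JC c x - v *m derJ c x u *m JC c x.

Lemma nijenhuisC_delta c x a b : chart_img c x ->
  nijenhuisC c x (delta_mx 0 a) (delta_mx 0 b) = 0.
Proof.
move=> cx; have dJ := smooth_on_differentiable (@acs_smooth _ _ _ _ J c) cx.
have D z (e : 'I_n) : 'D_z (fun y => delta_mx 0 e *m acs J c y : 'rV[R]_n) x =
   delta_mx 0 e *m 'D_z (acs J c) x.
  have dv : derivable (acs J c) x z by exact: diff_derivable.
  have dr : derivable (fun y => delta_mx 0 e *m acs J c y : 'rV[R]_n) x z.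
    apply/derivable_mxP => i j; rewrite (_ : (fun y => _) = fun y => acs J c y e j).
      by move/derivable_mxP: dv; exact.
    by apply/funext => y; rewrite -rowE mxE.
  rewrite derive_mx// [X in _ *m X]derive_mx// -rowE; apply/rowP => j; rewrite !mxE.
  by congr ('D_z _ x); apply/funext => y; rewrite -rowE mxE.
pose K := acs J c; pose ea : 'rV[R]_n := delta_mx 0 a;
  pose eb : 'rV[R]_n := delta_mx 0 b.
(* p3, p6, p7 and p8 are derivatives of constant fields *)
have alg (p1 p2 p3 p4 p5 p6 p7 p8 q1 q2 q4 q5 : 'rV[R]_n) :
    p1 = q1 -> p2 = q2 -> p3 = 0 -> p4 = q4 -> p5 = q5 -> p6 = 0 -> p7 = 0 -> p8 = 0 ->
    p1 - p2 - (p3 - p4) *m K x - (p5 - p6) *m K x - (p7 - p8) = 0 ->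
    q1 - q2 + q4 *m K x - q5 *m K x = 0.
  move=> -> -> -> -> -> -> -> ->.
  by rewrite subrr sub0r !subr0 mulNmx opprK.
have N := alg _ _ _ _ _ _ _ _ _ _ _ _ (D (ea *m K x) b) (D (eb *m K x) a)
  (derive_cst eb x (ea *m K x)) (D eb a) (D ea b) (derive_cst ea x (eb *m K x))
  (derive_cst eb x ea) (derive_cst ea x eb)
  (@J_int c (fun=> ea) (fun=> eb) (smooth_on_cst _ _) (smooth_on_cst _ _) x cx).
have -> : delta_mx 0 a = toC ea by rewrite map_delta_mx.
have -> : delta_mx 0 b = toC eb by rewrite map_delta_mx.
have e z := derJ_real z cx.
rewrite /nijenhuisC -/K.
rewrite -(map_mxM _ ea) -(map_mxM _ eb).
rewrite (e (ea *m K x)) (e (eb *m K x)) (e ea) (e eb).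
move: ('D_(ea *m K x) K x) ('D_(eb *m K x) K x) ('D_ea K x) ('D_eb K x) N =>
  P1 P2 P3 P4 N.
by rewrite -!map_mxM -map_mxB -map_mxD -map_mxB N map_mx0.
Qed.

(** By bilinearity, it is enough to consider the canonical basis, which is
    real. *)
Lemma nijenhuisC_eq0 c x u v : chart_img c x -> nijenhuisC c x u v = 0.
Proof.
move=> cx.
have lin (a b : C) u1 u2 v' : nijenhuisC c x (a *: u1 + b *: u2) v' =
    a *: nijenhuisC c x u1 v' + b *: nijenhuisC c x u2 v'.
  have alg (p1 p2 q1 q2 r1 r2 s1 s2 : 'rV[C]_n) :
      (a *: p1 + b *: p2) - (a *: q1 + b *: q2) + (a *: r1 + b *: r2) - (a *: s1 +
        b *: s2)
      = a *: (p1 - q1 + r1 - s1) + b *: (p2 - q2 + r2 - s2).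
    by apply/rowP => l; rewrite !mxE; ring.
  have mulD (B : 'M[C]_n) w1 w2 : (a *: w1 + b *: w2) *m B = a *: (w1 *m B) +
    b *: (w2 *m B).
    by rewrite mulmxDl -!scalemxAl.
  have mulDr (w : 'rV[C]_n) (B1 B2 : 'M[C]_n) :
      w *m (a *: B1 + b *: B2) = a *: (w *m B1) + b *: (w *m B2).
    by rewrite mulmxDr -!scalemxAr.
  rewrite -alg /nijenhuisC; congr (_ - _ + _ - _).
  - by rewrite mulD derJ_lin mulDr.
  - by rewrite mulD.
  - by rewrite (mulD _ (derJ c x v')) mulD.
  - by rewrite derJ_lin mulDr mulD.
have anti u' v' : nijenhuisC c x u' v' = - nijenhuisC c x v' u'.
  have alg (p q r s : 'rV[C]_n) : p - q + r - s = - (q - p + s - r).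
    by apply/rowP => l; rewrite !mxE; ring.
  exact: alg.
have sum0 v' : (forall a, nijenhuisC c x (delta_mx 0 a) v' = 0) ->
  forall u', nijenhuisC c x u' v' = 0.
  move=> E u'; rewrite (row_sum_delta u'); elim/big_rec: _ => [|a y _ IH].
    by have := lin 0 0 0 0 v'; rewrite !scale0r addr0.
  by rewrite -[y]scale1r lin E IH !scaler0 addr0.
apply: (sum0 v) => a; rewrite anti (sum0 (delta_mx 0 a)) ?oppr0// => b.
exact: nijenhuisC_delta.
Qed.

(** Up to a factor, this vector W is the bracket at x of the vector fields of
    type (0,1) that extend u and v by means of [proj01].  For u and v of type
    (0,1) the Nijenhuis tensor is - i W - W J. *)
Lemma integrable_bracket c x u v : chart_img c x -> type01 c x u -> type01 c x v ->
  type01 c x (v *m derJ c x u - u *m derJ c x v).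
Proof.
move=> cx tu tv; have := nijenhuisC_eq0 u v cx.
rewrite /nijenhuisC tu tv !derJZ /type01 mulmxBl -!scalemxAr.
have alg (p q r s : 'rV[C]_n) : - I *: p - (- I *: q) + s - r = 0 ->
  r - s = - I *: (p - q).
  move=> E; apply/eqP; rewrite -subr_eq0 -oppr_eq0 -E; apply/eqP.
  by apply/rowP => l; rewrite !mxE; ring.
exact: alg.
Qed.

(** The derivative of [proj01] along z is [- kappa *: derJ c x z]. *)
Let kappa : C := - (2^-1 * I).

(** Projecting row j with [proj01] extends it to a field of vectors of type
    (0,1), on which w vanishes identically.  Differentiating this identity
    trades the derivative of w for a value of w. *)
Lemma derC_kills01 k (w : preform k) c x V j z : is_form w -> kills01 w ->
  chart_img c x -> type01 c x (row j V) ->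
  derC z (fun y => w c y V) x = kappa * w c x (set_row j (row j V *m derJ c x z) V).
Proof.
move=> wf w01 cx t.
pose u y := row j V *m proj01 J c y.
have ux : u x = row j V by exact: type01_proj01.
have uE y l : u y 0 l = 2^-1 * (V j l + I * \sum_m V j m * JC c y m l).
  rewrite /u proj01E mxE; congr (_ * _).
  rewrite mxE; congr (_ + _); first by rewrite mxE.
  rewrite mxE; congr (_ * _); rewrite mxE.
  by apply: eq_bigr => m _; rewrite mxE.
have dJ m l : differentiableC (fun y => JC c y m l) x.
  exact: smoothC_differentiable (smoothC_acs c m l) cx.
have cst (b : C) := differentiableC_cst b x.
have dsum l : differentiableC (fun y => \sum_m V j m * JC c y m l) x.
  by apply: differentiableC_sum => m; exact: differentiableCM.
have du l : differentiableC (fun y => V j l + I * \sum_m V j m * JC c y m l) x.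
  by apply: differentiableCD => //; exact: differentiableCM.
have duu l : differentiableC (fun y => u y 0 l) x.
  rewrite (_ : (fun y => _) = fun y => 2^-1 * (V j l + I * \sum_m V j m * JC c y m l)).
    exact: differentiableCM.
  by apply/funext => y; exact: uE.
have := @derC_set_row _ _ _ _ (open_chart_img c) (w c)
  (fun y => @is_form_multilinear _ _ _ _ _ w c y wf)
  (fun V' => is_form_smooth c V' wf) z j u V x cx duu.
rewrite ux set_row_id (derC_ext (g := fun=> 0) z (open_chart_img c) cx); last first.
  move=> y cy; apply: (w01 _ _ _ j) => //; rewrite row_set_row; exact: proj01_type01.
have -> : derC z (fun=> 0) x = 0.
  by rewrite /derC big1// => a _; rewrite partialC_cst mulr0.
have -> : \row_l derC z (fun y => u y 0 l) x = (2^-1 * I) *: (row j V *m derJ c x z).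
  apply/rowP => l; rewrite !mxE.
  rewrite (_ : (fun y => _) = fun y => 2^-1 * (V j l + I * \sum_m V j m *
    JC c y m l)); last first.
    by apply/funext => y; exact: uE.
  rewrite derCZ// derCD//; last exact: differentiableCM.
  rewrite derCZ// derC_sum => [|m]; last exact: differentiableCM.
  rewrite {1}/derC big1 ?add0r => [|a _]; last by rewrite partialC_cst mulr0.
  by rewrite mulrA; congr (_ * _); apply: eq_bigr => m _; rewrite derCZ// !mxE.
rewrite multilinearZ; last exact: is_form_multilinear.
by move=> /esym/eqP; rewrite addr_eq0 => /eqP ->; rewrite /kappa mulNr.
Qed.

Lemma set_rows2l p a b : set_row ord0 p (rows2 a b) = rows2 p b :> 'M[C]_(2, n).
Proof. by apply/row_matrixP => j; rewrite !rowK; case: eqP. Qed.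

Lemma set_rows2r q a b : set_row ord_max q (rows2 a b) = rows2 a q :> 'M[C]_(2, n).
Proof.
apply/row_matrixP => j; rewrite !rowK.
by case: (eqVneq j ord0) => [->|/ord2P ->]; rewrite ?eqxx.
Qed.

Lemma rows2_swap (w : preform 2) c x a b : is_form w -> chart_img c x ->
  w c x (rows2 a b) = - w c x (rows2 b a).
Proof.
move=> wf cx; have wm := is_form_multilinear wf cx.
have w0 v : w c x (rows2 v v) = 0.
  by apply: (is_form_alternating wf cx (i1 := ord0) (i2 := ord_max)) => //;
    rewrite !rowK.
have := w0 (a + b); rewrite -(set_rows2l _ 0) multilinearD// !set_rows2l.
rewrite -(set_rows2r _ a 0) -(set_rows2r _ b 0) !multilinearD// !set_rows2r.
by rewrite !w0 add0r addr0 => /eqP; rewrite addr_eq0 => /eqP.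
Qed.

(** By [derC_kills01] the two terms combine into the value of g on the vector
    of [integrable_bracket]. *)
Lemma ext_d1_kills01 (g : preform 1) c x u v : is_form g -> kills01 g ->
  chart_img c x -> type01 c x u -> type01 c x v -> ext_d g c x (rows2 u v) = 0.
Proof.
move=> gf g01 cx tu tv; rewrite ext_d1E.
have gm := is_form_multilinear gf cx.
have L z t : type01 c x t -> derC z (fun y => g c y t) x = kappa *
  g c x (t *m derJ c x z).
  move=> tt; have rid : row ord0 t = t by apply/rowP => a; rewrite mxE.
  by rewrite (derC_kills01 (j := ord0)) ?rid ?set_row1.
rewrite !L// -mulrBr -mulN1r -[g c x (v *m _)]mul1r.
rewrite -(set_row1 (v *m derJ c x u) 0) -(set_row1 (u *m derJ c x v) 0).
have /multilinearP := gm; move=> /(_ ord0 1 (-1)) <-.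
rewrite set_row1 scale1r scaleN1r (g01 c x _ ord0)// ?mulr0//.
by rewrite row_id; exact: integrable_bracket.
Qed.

(** The two terms that differentiate along one of the vectors of type (0,1)
    combine as in degree one; in the third term both vectors of type (0,1) are
    arguments of w, and it vanishes by [derC_kills01]. *)
Lemma ext_d2_kills01 (w : preform 2) c x V i j : is_form w -> kills01 w ->
  chart_img c x -> i != j -> type01 c x (row i V) -> type01 c x (row j V) ->
  ext_d w c x V = 0.
Proof.
move=> wf w01 cx.
have wm := is_form_multilinear wf cx.
have Ll z a b : type01 c x a ->
    derC z (fun y => w c y (rows2 a b)) x = kappa * w c x (rows2 (a *m derJ c x z) b).
  move=> ta; rewrite (derC_kills01 (j := ord0))// ?row_rows2l// ?set_rows2l//.
have Lr z a b : type01 c x b ->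
    derC z (fun y => w c y (rows2 a b)) x = kappa * w c x (rows2 a (b *m derJ c x z)).
  move=> ta; rewrite (derC_kills01 (j := ord_max))// ?row_rows2r// ?set_rows2r//.
have w0l a b : type01 c x a -> w c x (rows2 a b) = 0.
  by move=> ta; apply: (w01 _ _ _ ord0) => //; rewrite row_rows2l.
have w0r a b : type01 c x b -> w c x (rows2 a b) = 0.
  by move=> ta; apply: (w01 _ _ _ ord_max) => //; rewrite row_rows2r.
have bracket u v z : type01 c x u -> type01 c x v ->
    w c x (rows2 (v *m derJ c x u) z) = w c x (rows2 (u *m derJ c x v) z).
  move=> tu tv; apply/eqP; rewrite -subr_eq0 -mulN1r -[X in X + _]mul1r.
  rewrite -(set_rows2l _ 0) -(set_rows2l (u *m _) 0).
  have /multilinearP := wm; move=> /(_ ord0 1 (-1)) <-.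
  rewrite set_rows2l scale1r scaleN1r w0l//; exact: integrable_bracket.
rewrite (rows3E V); move: (row ord0 V) (row (lift _ _) V) (row ord_max V) => u v z.
have H1 : type01 c x u -> type01 c x v -> ext_d w c x (rows3 u v z) = 0.
  move=> tu tv; rewrite ext_d2E Ll// Ll// Ll// (w0r _ v)// mulr0 addr0.
  by rewrite (bracket u v)// subrr.
have H2 : type01 c x u -> type01 c x z -> ext_d w c x (rows3 u v z) = 0.
  move=> tu tz; rewrite ext_d2E Lr// Ll// Ll// (w0r _ z)// mulr0 subr0.
  by rewrite rows2_swap// (bracket u z)// mulrN addNr.
have H3 : type01 c x v -> type01 c x z -> ext_d w c x (rows3 u v z) = 0.
  move=> tv tz; rewrite ext_d2E Lr// Lr// Lr// (w0l v)// mulr0 sub0r.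
  by rewrite rows2_swap// (bracket v z)// mulrN opprK rows2_swap// mulrN addNr.
have R0 : row ord0 (rows3 u v z) = u by rewrite rowK.
have R1 : row (lift ord0 ord0) (rows3 u v z) = v by rewrite rowK.
have R2 : row ord_max (rows3 u v z) = z by rewrite rowK.
case: (eqVneq i ord0) => [->|i0]; [|case: (eqVneq i ord_max) => [->|im]];
  last rewrite (ord3P i0 im).
all: case: (eqVneq j ord0) => [->|j0]; [|case: (eqVneq j ord_max) => [->|jm]];
  last rewrite (ord3P j0 jm).
all: rewrite ?R0 ?R1 ?R2 ?eqxx// => _ t1 t2.
all: by first [exact: H1|exact: H2|exact: H3].
Qed.

End Integrability.
End Types.

(** * Bidegrees *)

Section Bidegrees.
Variables (R : realType) (n : nat) (M : topologicalType) (A : atlas R n M).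
Variable J : almost_complex A.
Local Notation C := R[i].
Local Notation toC := (map_mx (real_complex R)).
Local Notation preform := (preform A).
Local Notation JC c x := (toC (acs J c x)).
Local Notation I := ('i%C : C).

Hint Resolve open_chart_img overlap_open : core.

Definition pure k c x (S : {set 'I_k}) (V : 'M[C]_(k, n)) :=
  forall j, row j V *m JC c x = (if j \in S then I else - I) *: row j V.

Lemma pure_in k c x (S : {set 'I_k}) V j : pure c x S V -> j \in S ->
  type10 J c x (row j V).
Proof. by move=> /(_ j) + jS; rewrite jS. Qed.

Lemma pure_notin k c x (S : {set 'I_k}) V j : pure c x S V -> j \notin S ->
  type01 J c x (row j V).
Proof. by move=> /(_ j) + jS; rewrite (negbTE jS). Qed.

Lemma pure_conj k c x (S : {set 'I_k}) V : pure c x S V ->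
  pure c x (~: S) (map_mx conjc V).
Proof.
move=> pV j; rewrite inE -map_row; case: ifPn => jS.
  exact: type01_conj (pure_notin pV jS).
by move: jS; rewrite negbK => jS; exact: type10_conj (pure_in pV jS).
Qed.

Lemma bidegree_in_conj k P (w : preform k) :
  bidegree_in J P w -> bidegree_in J (fun a b => P b a) (conj_form w).
Proof.
move=> wP c x V S cx pV nP; rewrite /conj_form (wP c x _ (~: S))// ?conjc0//.
  exact: pure_conj.
by rewrite finset.setCK.
Qed.

Lemma bidegree_inW k (P P' : nat -> nat -> bool) (w : preform k) :
  (forall a b, (a + b = k)%N -> P a b -> P' a b) ->
  bidegree_in J P w -> bidegree_in J P' w.
Proof.
move=> PP wP c x V S cx pV nP; apply: (wP c x V S) => //.
by apply: contra nP; apply: PP; rewrite cardsC card_ord.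
Qed.

Lemma bidegree_in_ext k P (w w' : preform k) : form_eq w w' ->
  bidegree_in J P w -> bidegree_in J P w'.
Proof. by move=> E wP c x V S cx pV nP; rewrite -E//; exact: wP pV nP. Qed.

Lemma bidegree_in0 k P : bidegree_in J P (0 : preform k).
Proof. by []. Qed.

Lemma bidegree_in_lin k P (w w' : preform k) (a b : C) :
  bidegree_in J P w -> bidegree_in J P w' ->
  bidegree_in J P (fun c x V => a * w c x V + b * w' c x V).
Proof.
by move=> wP wP' c x V S cx pV nP; rewrite (wP _ _ _ _ cx pV)// (wP' _ _ _ _ cx pV)//
  !mulr0 addr0.
Qed.

Lemma multilinear_rowmul k (f : 'M[C]_(k, n) -> C) (Q : 'I_k -> 'M[C]_n) :
  multilinear f -> multilinear (fun V => f (\matrix_j (row j V *m Q j))).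
Proof.
move=> fl; apply/multilinearP => i a b u v V.
have E z : \matrix_j (row j (set_row i z V) *m Q j) =
    set_row i (z *m Q i) (\matrix_j (row j V *m Q j)).
  by apply/row_matrixP => j; rewrite !rowK; case: eqP => [->|_].
by rewrite !E mulmxDl -(scalemxAl a u) -(scalemxAl b v); move/multilinearP: fl; exact.
Qed.

Lemma multilinear_bigsum k (T : Type) (r : seq T) (P : pred T) (F : T ->
  'M[C]_(k, n) -> C) :
  (forall t, multilinear (F t)) -> multilinear (fun V => \sum_(t <- r | P t) F t V).
Proof.
move=> Fl; apply/multilinearP => i a b u v V; rewrite !mulr_sumr -big_split/=.
by apply: eq_bigr => t _; rewrite multilinearD// !multilinearZ.
Qed.

Lemma component_multilinear k p q (w : preform k) c x : is_form w -> chart_img c x ->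
  multilinear (component J p q w c x).
Proof.
move=> wf cx; apply: multilinear_bigsum => S.
exact: (multilinear_rowmul (fun j => if j \in S then proj10 J c x else proj01 J c x)
  (is_form_multilinear wf cx)).
Qed.

(** On a tuple of pure type S, the summand of index S' has a zero row unless
    S' = S. *)
Lemma component_pureE k p q (w : preform k) c x S V : is_form w -> chart_img c x ->
  pure c x S V ->
  component J p q w c x V = if (#|S| == p) && (#|~: S| == q) then w c x V else 0.
Proof.
move=> wf cx pV; have wm := is_form_multilinear wf cx.
have term (S' : {set 'I_k}) : w c x (\matrix_j (row j V *m (if j \in S' then proj10 J
  c x else proj01 J c x)))
    = if S' == S then w c x V else 0.
  case: (eqVneq S' S) => [->|SS].
    congr (w c x _); apply/row_matrixP => j; rewrite rowK; case: ifPn => jS.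
      exact: type10_proj10 (pure_in pV jS).
    exact: type01_proj01 (pure_notin pV jS).
  have [j Sj] : exists j, (j \in S') != (j \in S).
    apply/existsP; apply: contraNT SS => /existsPn E; apply/eqP/setP => j.
    by apply/eqP; have := E j; rewrite negbK.
  apply: (multilinear_row0 (i := j)) => //; rewrite rowK.
  move: Sj; case: (boolP (j \in S')) => jS' /=; case: (boolP (j \in S)) => jS // _.
    exact: type01_proj10 (pure_notin pV jS).
  exact: type10_proj01 (pure_in pV jS).
rewrite /component; under eq_bigr do rewrite term.
by rewrite -big_mkcondr/= big_mkcond/= -big_mkcond/= big_mkcondl/= big_pred1_eq.
Qed.

Lemma form_eq_pure k (w w' : preform k) :
  (forall c x, chart_img c x -> multilinear (w c x)) ->
  (forall c x, chart_img c x -> multilinear (w' c x)) ->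
  (forall c x V S, chart_img c x -> pure c x S V -> w c x V = w' c x V) ->
  form_eq w w'.
Proof.
move=> wm wm' E c x V cx; apply/eqP; rewrite -subr_eq0; apply/eqP.
rewrite -[X in X - _]mul1r -mulN1r.
apply: (pure_eq0 cx (multilinear_lin 1 (-1) (wm c x cx) (wm' c x cx))) => {}V S pV /=.
by rewrite (E c x V S)// mul1r mulN1r subrr.
Qed.

Lemma component_id k p q (w : preform k) : is_form w -> has_bidegree J p q w ->
  form_eq (component J p q w) w.
Proof.
move=> wf wpq; apply: form_eq_pure => [c x|c x|c x V S cx pV].
- exact: component_multilinear.
- exact: is_form_multilinear.
rewrite (component_pureE _ _ wf cx pV); case: ifPn => // PS.
by rewrite (wpq c x V S).
Qed.

Lemma component_ext k p q (w w' : preform k) : form_eq w w' ->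
  form_eq (component J p q w) (component J p q w').
Proof. by move=> E c x V cx; apply: eq_bigr => S _; exact: E. Qed.

Lemma component0 k p q : form_eq (component J p q (0 : preform k)) 0.
Proof. by move=> c x V cx; rewrite /component big1. Qed.

End Bidegrees.

(** * De Rham classes and real forms *)

Section Classes.
Variables (R : realType) (n : nat) (M : topologicalType) (A : atlas R n M).
Local Notation C := R[i].
Local Notation toC := (map_mx (real_complex R)).
Local Notation preform := (preform A).

Implicit Types w u v : preform 2.

Lemma form0E k c x V : (0 : Defs.preform A k) c x V = 0.
Proof. by []. Qed.

Definition cohomologous (w w' : preform 2) :=
  exists g : preform 1, is_form g /\ form_eq (w' - w) (ext_d g).

Lemma form_eq_cohomologous w w' : form_eq w w' -> cohomologous w w'.
Proof.
move=> E; exists 0; split; first exact: is_form0.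
by move=> c x V cx; rewrite ext_d0//= !fctE E// subrr.
Qed.

Lemma cohomologous_sym w w' : cohomologous w w' -> cohomologous w' w.
Proof.
move=> [g [gf E]]; exists (0 - g); split; first by apply: is_formB => //;
  exact: is_form0.
move=> c x V cx; rewrite (ext_dB (is_form0 _ _) gf)//= !fctE ext_d0// -E//= !fctE.
by rewrite form0E sub0r opprB.
Qed.

Lemma cohomologous_trans w1 w2 w3 :
  cohomologous w1 w2 -> cohomologous w2 w3 -> cohomologous w1 w3.
Proof.
move=> [g [gf E]] [g' [gf' E']]; exists (g' + g); split; first exact: is_formD.
by move=> c x V cx; rewrite (ext_dD gf' gf)//= !fctE -E// -E'//= !fctE subrKA.
Qed.

Lemma deRham_class_self w : closed_form w -> deRham_class w w.
Proof. by move=> wc; split => //; exact: form_eq_cohomologous. Qed.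

Lemma deRham_class_eq w w' : cohomologous w w' -> deRham_class w = deRham_class w'.
Proof.
move=> E; apply/seteqP; split => u [uc Eu]; split => //.
  exact: cohomologous_trans (cohomologous_sym E) Eu.
exact: cohomologous_trans E Eu.
Qed.

Lemma deRham_class_inj w w' : closed_form w' ->
  deRham_class w = deRham_class w' -> cohomologous w w'.
Proof. by move=> wc E; have := deRham_class_self wc; rewrite -E => -[]. Qed.

Lemma conj_formK k : involutive (@conj_form R n M A k).
Proof.
move=> w; apply/funext => c; apply/funext => x; apply/funext => V.
rewrite /conj_form conjcK; congr (w c x _).
by apply/matrixP => i j; rewrite !mxE conjcK.
Qed.

Lemma cohomologous_conj w w' : cohomologous w w' ->
  cohomologous (conj_form w) (conj_form w').
Proof.
move=> [g [gf E]]; exists (conj_form g); split; first exact: is_form_conj.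
move=> c x V cx; rewrite ext_d_conj// /conj_form -E//= !fctE.
by rewrite /conj_form rmorphB.
Qed.

Lemma class_conj_deRham w : class_conj (deRham_class w) = deRham_class (conj_form w).
Proof.
apply/seteqP; split => [_ [u [uc E] <-]|u [uc E]].
  by split; [exact: closed_form_conj|exact: cohomologous_conj].
exists (conj_form u); last exact: conj_formK.
by split; [exact: closed_form_conj|rewrite -(conj_formK w); exact: cohomologous_conj].
Qed.

Lemma class_add_deRham (a b : preform 2) : closed_form a -> closed_form b ->
  class_add (deRham_class a) (deRham_class b) = deRham_class (a + b).
Proof.
move=> ac bc; apply/seteqP; split => [_ [u [uc [g [gf E]]] [v [vc [h [hf F]]]] <-]|u
  [uc [g [gf E]]]].
  split; first exact: closed_formD.
  exists (g + h); split; first exact: is_formD.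
  by move=> c x V cx; rewrite (ext_dD gf hf)//= !fctE -E// -F//= !fctE addrACA opprD.
exists a; first exact: deRham_class_self.
exists (u - a); last by rewrite addrC subrK.
split; first exact: closed_formB.
exists g; split => // c x V cx; rewrite -E//= !fctE.
by rewrite opprD addrA.
Qed.

(** A multilinear function is determined by its values on real vectors. *)
Lemma real_form_conj k (w : Defs.preform A k) : is_form w -> real_form w ->
  form_eq (conj_form w) w.
Proof.
move=> wf wr c x V cx; apply/eqP; rewrite -subr_eq0; apply/eqP.
rewrite -[X in X - _]mul1r -mulN1r.
have wm := is_form_multilinear wf cx.
pose G (v : 'rV[C]_n) := exists r : 'rV[R]_n, v = toC r.
apply: (multilinear_span (G := G) (multilinear_lin 1 (-1) (multilinear_conj wm) wm)).
  move=> v; exists 1, 'i%C, (toC (map_mx (@complex.Re R) v)), (toC (map_mx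
    (@complex.Im R) v)).
  split; [by eexists|by eexists|].
  apply/rowP => a; rewrite !mxE mul1r; case: (v 0 a) => p q /=.
  by apply/eqP; rewrite eq_complex /= !(mul0r, mul1r, mulr0, subr0, addr0, add0r) !eqxx.
move=> {}V GV; pose B : 'M[R]_(k, n) := map_mx (@complex.Re R) V.
have -> : V = toC B.
  apply/row_matrixP => j; have [r rE] := GV j; rewrite rE; apply/rowP => a.
  have /rowP/(_ a) := rE; rewrite !mxE => ->.
  by [].
rewrite conj_toC; have := wr c x B cx; case: (w c x (toC B)) => p q /= ->.
by rewrite mul1r mulN1r; apply/eqP; rewrite subr_eq0 eq_complex /= oppr0 !eqxx.
Qed.

Lemma conj_real_form k (w : Defs.preform A k) : form_eq (conj_form w) w -> real_form w.
Proof.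
move=> E c x V cx; have := E c x (toC V) cx; rewrite /conj_form conj_toC.
case: (w c x _) => p q [] /= /eqP; rewrite eq_sym -subr_eq0 opprK -mulr2n.
by rewrite mulrn_eq0 /= => /eqP.
Qed.

Definition re_form k (w : Defs.preform A k) : Defs.preform A k :=
  fun c x V => 2^-1 * w c x V + 2^-1 * conj_form w c x V.

Lemma re_form_real k (w : Defs.preform A k) : real_form (re_form w).
Proof.
apply: conj_real_form => c x V cx; rewrite {1}/conj_form /re_form.
have half (z1 z2 : C) : conjc (2^-1 * z1 + 2^-1 * z2) = 2^-1 * conjc z1 + 2^-1 *
  conjc z2.
  by rewrite rmorphD !rmorphM fmorphV rmorph_nat.
rewrite half addrC; congr (_ * _ + _ * _).
rewrite /conj_form conjcK; congr (w c x _).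
by apply/matrixP => i j; rewrite !mxE conjcK.
Qed.

Lemma is_form_re k (w : Defs.preform A k) : is_form w -> is_form (re_form w).
Proof. by move=> wf; apply: is_form_lin => //; exact: is_form_conj. Qed.

Lemma ext_d_re k (w : Defs.preform A k) : is_form w ->
  form_eq (ext_d (re_form w)) (re_form (ext_d w)).
Proof.
move=> wf; apply: form_eq_trans (ext_d_lin _ _ wf (is_form_conj wf)) _.
by move=> c x V cx; rewrite ext_d_conj.
Qed.

Lemma closed_form_re k (w : Defs.preform A k) : closed_form w ->
  closed_form (re_form w).
Proof.
move=> [wf dw]; split; first exact: is_form_re.
apply: form_eq_trans (ext_d_re wf) _ => c x V cx.
by rewrite /re_form /conj_form !dw// conjc0 !mulr0 addr0.
Qed.

Lemma re_form_id k (w : Defs.preform A k) : is_form w -> real_form w ->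
  form_eq (re_form w) w.
Proof.
move=> wf wr c x V cx; rewrite /re_form real_form_conj// -mulrDr -mulr2n.
by rewrite -[w c x V *+ 2]mulr_natl mulrA mulVf ?mul1r// pnatr_eq0.
Qed.

Lemma deRham_classR_eq w w' :
  (exists g : preform 1, [/\ is_form g, real_form g & form_eq (w' - w) (ext_d g)]) ->
  deRham_classR w = deRham_classR w'.
Proof.
have realD (g g' : preform 1) : real_form g -> real_form g' -> real_form (g + g').
  move=> gr gr' c x V cx; have := gr c x V cx; have := gr' c x V cx; rewrite /= !fctE.
  by case: (g c x _) (g' c x _) => p q [p' q'] /= -> ->; rewrite addr0.
have realN (g : preform 1) : real_form g -> real_form (0 - g).
  move=> gr c x V cx; have := gr c x V cx; rewrite /= !fctE.
  by case: (g c x _) => p q /= ->; rewrite subr0.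
move=> [g [gf gr E]]; apply/seteqP; split => u [uc ur [h [hf hr F]]]; split => //.
- exists (h + (0 - g)); split.
  + by apply: is_formD => //; apply: is_formB => //; exact: is_form0.
  + by apply: realD => //; exact: realN.
  move=> c x V cx.
  have f0 : is_form (0 - g) by apply: is_formB => //; exact: is_form0.
  rewrite (ext_dD hf f0)//= !fctE (ext_dB (is_form0 _ _) gf)//= !fctE ext_d0//.
  rewrite form0E sub0r -E// -F//= !fctE opprB.
  by rewrite subrKA.
- exists (h + g); split; [exact: is_formD|exact: realD|].
  by move=> c x V cx; rewrite (ext_dD hf gf)//= !fctE -E// -F//= !fctE subrKA.
Qed.

Lemma deRham_classR_self w : closed_form w -> real_form w -> deRham_classR w w.
Proof.
move=> wc wr; split => //; exists 0; split; first exact: is_form0.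
  by [].
by move=> c x V cx; rewrite ext_d0//= !fctE subrr.
Qed.

Lemma complexify_deRham w : closed_form w -> real_form w ->
  complexify (deRham_classR w) = deRham_class w.
Proof.
move=> wc wr; apply/seteqP; split => [u [v [vc _ [g [gf _ E]]] uv]|u uw].
  by rewrite (@deRham_class_eq w v)//; exists g.
by exists w => //; exact: deRham_classR_self.
Qed.

(** If w - w0 = dg with w0 real, then Re w - w0 = d (Re g). *)
Lemma deRham_classR_re w0 w : closed_form w0 -> real_form w0 -> closed_form w ->
  deRham_class w0 = deRham_class w -> deRham_classR w0 = deRham_classR (re_form w).
Proof.
move=> wc0 wr0 wc E; apply: deRham_classR_eq.
have [g [gf F]] := deRham_class_inj wc E.
exists (re_form g); split; [exact: is_form_re|exact: re_form_real|].
move=> c x V cx; rewrite ext_d_re//= !fctE -(re_form_id wc0.1 wr0)//.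
rewrite /re_form /conj_form -!F//= !fctE rmorphB; ring.
Qed.

End Classes.

(** * The Hodge filtration and forms of pure type *)

Section HodgeClasses.
Variables (R : realType) (n : nat) (M : topologicalType) (A : atlas R n M).
Variable J : almost_complex A.
Local Notation C := R[i].
Local Notation toC := (map_mx (real_complex R)).
Local Notation preform := (preform A).
Local Notation JC c x := (toC (acs J c x)).
Local Notation I := ('i%C : C).

Hint Resolve open_chart_img overlap_open : core.

Lemma deRham_class_conjE (w : preform 2) :
  class_conj (deRham_class (conj_form w)) = deRham_class w.
Proof. by rewrite class_conj_deRham conj_formK. Qed.

Lemma subset_ord2 (S : {set 'I_2}) : [\/ #|S| = 1%N, S = finset.set0 | S = finset.setT].
Proof.
have := max_card (mem S); rewrite card_ord.
case E : #|S| => [|[|[|//]]] _; first by apply: Or32; apply: cards0_eq.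
  exact: Or31.
by apply: Or33; apply/eqP; rewrite eqEcard finset.subsetT cardsT card_ord E.
Qed.

Lemma dolbeault_subspace_filtration p q e : dolbeault_subspace J p q e ->
  (hodge_filtration J p `&` subspace_conj (hodge_filtration J q)) e.
Proof. by move=> [u _ [+ _]]. Qed.

Lemma dolbeault_cycle_component p q (w : preform 2) :
  closed_form w -> has_bidegree J p q w -> dolbeault_cycle J p q (component J p q w).
Proof.
move=> [wf dw] wpq; have E := component_id wf wpq; split.
- exact: is_form_ext (form_eq_sym E) wf.
- exact: bidegree_in_ext (form_eq_sym E) wpq.
- have E' : form_eq (ext_d (component J p q w)) 0.
    exact: form_eq_trans (ext_d_ext E) dw.
  by apply: form_eq_trans (component_ext J p q.+1 E') _; exact: component0.
Qed.

Lemma HJ_sub_filtration p q : HJ J p q `<=`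
  hodge_filtration J p `&` subspace_conj (hodge_filtration J q).
Proof.
move=> _ [w [wc wpq] <-]; split.
  exists w; last by [].
  by split; [exact: wc|apply: bidegree_inW wpq => a b _ /andP[/eqP -> _]].
exists (deRham_class (conj_form w)); last exact: deRham_class_conjE.
exists (conj_form w); last by [].
split; first exact: closed_form_conj.
by apply: bidegree_inW (bidegree_in_conj wpq) => a b _ /andP[_ /eqP ->].
Qed.

Lemma HJ_sub_dolbeault p q : HJ J p q `<=` dolbeault_subspace J p q.
Proof.
move=> _ [w [wc wpq] <-]; exists (dolbeault_class J p q (component J p q w)).
  by exists (component J p q w); last by []; exact: dolbeault_cycle_component.
split; first by apply: HJ_sub_filtration; exists w.
exists w; split; [exact: wc| |by []|by []].
by apply: bidegree_inW wpq => a b _ /andP[/eqP -> _].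
Qed.

Section Integrable.
Hypothesis J_int : integrable_acs J.

(** The difference g - [part10 J g] is of type (0,1), so [ext_d1_kills01]
    applies to its conjugate. *)
Lemma ext_d1_part10_type10 (g : preform 1) c x V : is_form g -> chart_img c x ->
  pure J c x finset.setT V -> ext_d (part10 J g) c x V = ext_d g c x V.
Proof.
move=> gf cx pV; have g10f := is_form_part10 J gf.
pose h := g - part10 J g.
have hf : is_form h by exact: is_formB.
have ch : kills01 J (conj_form h).
  move=> c' x' v j cx' t; rewrite /conj_form /h /= !fctE /part10.
  have t' : type10 J c' x' (map_mx conjc v).
    have -> : map_mx conjc v = map_mx conjc (row j v).
      by apply/rowP => a; rewrite !mxE ord1.
    exact: type01_conj.
  by rewrite type10_proj10// subrr conjc0.
have dh : ext_d h c x V = 0.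
  set W := map_mx conjc V.
  have K : ext_d (conj_form h) c x W = 0.
    rewrite (rows2E W); apply: (ext_d1_kills01 J_int (is_form_conj hf) ch cx);
      by rewrite -map_row; apply: type10_conj; apply: (pure_in pV); rewrite inE.
  have VE : map_mx conjc W = V by apply/matrixP => i j; rewrite !mxE conjcK.
  have := ext_d_conj hf W cx; rewrite K /conj_form VE => /esym/eqP.
  by rewrite conjc_eq0 => /eqP.
have := ext_dB gf g10f V cx; rewrite -/h dh => /esym E.
exact: esym (subr0_eq E).
Qed.

(** With a - conj b = dg, the representative is a - d g10, where g10 is the
    (1,0) part of g. *)
Lemma filtration11_HJ (a b : preform 2) : closed_form a -> closed_form b ->
  bidegree_in J (fun p _ => (1 <= p)%N) a -> bidegree_in J (fun p _ => (1 <= p)%N) b ->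
  deRham_class a = deRham_class (conj_form b) -> HJ J 1 1 (deRham_class a).
Proof.
move=> ac bc a1 b1 E.
have [g [gf F]] := deRham_class_inj ac (esym E).
have g10f := is_form_part10 J gf.
exists (a - ext_d (part10 J g)); last first.
  apply: deRham_class_eq; exists (part10 J g); split; first exact: g10f.
  move=> c x V cx.
  by rewrite /= !fctE opprB addrC subrK.
split; first exact: closed_formB ac (closed_ext_d1 g10f).
move=> c x V S cx pV nS; rewrite /= !fctE.
have [S1|S0|ST] := subset_ord2 S.
- have S2 : #|~: S| = 1%N by have := cardsC S; rewrite S1 card_ord; lia.
  by move: nS; rewrite S1 S2 eqxx.
- rewrite (a1 c x V S)// ?S0 ?cards0// sub0r (rows2E V).
  by rewrite (ext_d1_kills01 J_int) ?oppr0//; [exact: part10_kills01|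
    apply: (pure_notin pV); rewrite S0 inE..].
- rewrite ext_d1_part10_type10//; last by rewrite -ST.
  rewrite -F//= !fctE opprB addrC subrK /conj_form.
  rewrite (b1 c x _ (~: S)%SET)// ?conjc0//; first exact: pure_conj.
  by rewrite ST finset.setCT cards0.
Qed.

Lemma filtration20_bidegree (w : preform 2) : bidegree_in J (fun p _ =>
  (2 <= p)%N) w -> has_bidegree J 2 0 w.
Proof. by apply: bidegree_inW => a b ab a2; apply/andP; split; apply/eqP; lia. Qed.

Lemma filtration_sub_HJ p q : (p + q = 2)%N ->
  hodge_filtration J p `&` subspace_conj (hodge_filtration J q) `<=` HJ J p q.
Proof.
move=> pq e [[a [ac a1] <-] [_ [b [bc b1] <-]]]; rewrite class_conj_deRham => E.
case: p q pq a1 b1 => [|[|[|//]]] [|[|[|//]]] // _ a1 b1.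
- rewrite -E; exists (conj_form b); last by [].
  split; first exact: closed_form_conj.
  by apply: bidegree_inW (bidegree_in_conj (filtration20_bidegree b1)) => p q _;
    rewrite andbC.
- exact: filtration11_HJ (esym E).
- by exists a; [split; [exact: ac|exact: filtration20_bidegree]|].
Qed.

Lemma HJ_dolbeault p q : (p + q = 2)%N -> HJ J p q = dolbeault_subspace J p q.
Proof.
move=> pq; apply/seteqP; split; first exact: HJ_sub_dolbeault.
by move=> e /dolbeault_subspace_filtration; exact: filtration_sub_HJ.
Qed.

Lemma J_pullback_multilinear (w : preform 2) c x : is_form w -> chart_img c x ->
  multilinear (J_pullback J w c x).
Proof. by move=> wf cx; apply: multilinear_mul; exact: is_form_multilinear. Qed.

(** J multiplies the two arguments by i or - i, hence the value by - 1 if they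
    have the same type and by 1 otherwise. *)
Lemma J_pullback_pure (w : preform 2) c x V S : is_form w -> chart_img c x ->
  pure J c x S V ->
  J_pullback J w c x V = if #|S| == 1%N then w c x V else - w c x V.
Proof.
move=> wf cx pV; have wm := is_form_multilinear wf cx.
have E (e1 e2 : C) u v : w c x (rows2 (e1 *: u) (e2 *: v)) = e1 * e2 *
  w c x (rows2 u v).
  rewrite -(set_rows2l _ 0) multilinearZ// set_rows2l -(set_rows2r _ _ 0)
    multilinearZ//.
  by rewrite set_rows2r mulrA.
have cS : #|S| = ((ord0 \in S) + (ord_max \in S))%N.
  rewrite -sum1_card big_mkcond big_ord_recl big_ord1 /=.
  rewrite (_ : lift ord0 ord0 = ord_max); last exact: val_inj.
  by case: (_ \in _) (_ \in _) => [] [].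
rewrite /J_pullback.
have -> : V *m JC c x = rows2 ((if ord0 \in S then I else - I) *: row ord0 V)
    ((if ord_max \in S then I else - I) *: row ord_max V).
  by rewrite -!pV [LHS]rows2E !row_mul.
rewrite E -rows2E cS; case: (ord0 \in S); case: (ord_max \in S) => /=.
- by rewrite sqrI mulN1r.
- by rewrite mulrN sqrI opprK mul1r.
- by rewrite mulNr sqrI opprK mul1r.
- by rewrite mulrNN sqrI mulN1r.
Qed.

Lemma self_opp_eq0 (z : C) : z = - z -> z = 0.
Proof.
by move=> /eqP; rewrite -subr_eq0 opprK -mulr2n mulrn_eq0 /= => /eqP.
Qed.

Lemma J_invariantP (w : preform 2) : is_form w ->
  form_eq (J_pullback J w) w <-> has_bidegree J 1 1 w.
Proof.
move=> wf; split=> [E c x V S cx pV nS|w11 c x V cx].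
  have := J_pullback_pure wf cx pV; rewrite E// ifF.
    exact: self_opp_eq0.
  apply: contraNF nS => /eqP S1; rewrite S1.
  by have := cardsC S; rewrite S1 card_ord => S2; rewrite (_ : #|~: S| = 1%N)//; lia.
move: c x V cx; apply: (form_eq_pure (J := J)) => [c x|c x|c x V S cx pV].
- exact: J_pullback_multilinear.
- exact: is_form_multilinear.
rewrite (J_pullback_pure wf cx pV); case: ifPn => // S1.
by rewrite (w11 c x V S)// ?oppr0//; rewrite (negbTE S1).
Qed.

Lemma J_antiinvariantP (w : preform 2) : is_form w ->
  form_eq (J_pullback J w) (- w) <-> bidegree_in J (fun p _ => p != 1)%N w.
Proof.
move=> wf; split=> [E c x V S cx pV nS|w11 c x V cx].
  have := J_pullback_pure wf cx pV; rewrite E// ifT; last by rewrite -[_ == _]negbK.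
  by move=> /esym; rewrite /= !fctE; exact: self_opp_eq0.
move: c x V cx; apply: (form_eq_pure (J := J)) => [c x|c x|c x V S cx pV].
- exact: J_pullback_multilinear.
- move=> cx; have := multilinear_lin (-1) 0 (is_form_multilinear wf cx)
    (is_form_multilinear wf cx).
  by congr multilinear; apply/funext => V; rewrite /= !fctE mulN1r mul0r addr0.
rewrite (J_pullback_pure wf cx pV) /= !fctE; case: ifPn => // S1.
by rewrite (w11 c x V S)// ?oppr0//; rewrite S1.
Qed.

Lemma has_bidegree11_re (w : preform 2) : has_bidegree J 1 1 w ->
  has_bidegree J 1 1 (re_form w).
Proof.
move=> w11; apply: bidegree_in_lin => //.
by apply: bidegree_inW (bidegree_in_conj w11) => a b _; rewrite andbC.
Qed.

Lemma bidegree_neq1_re (w : preform 2) : bidegree_in J (fun p _ => p != 1)%N w ->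
  bidegree_in J (fun p _ => p != 1)%N (re_form w).
Proof.
move=> w1; apply: bidegree_in_lin => //.
by apply: bidegree_inW (bidegree_in_conj w1) => a b ab; apply: contra => /eqP; lia.
Qed.

Lemma HJplusE : HJplus J = real_points (dolbeault_subspace J 1 1).
Proof.
rewrite -HJ_dolbeault//; apply/seteqP; split =>
  [_ [w [wc wr wJ] <-]|u [[w [wc wr _] <-]]].
  split; first by exists w.
  by rewrite complexify_deRham//; exists w; [split;
    [exact: wc|apply/J_invariantP => //; exact: wc.1]|].
rewrite complexify_deRham// => -[a [ac a11] E].
exists (re_form a); last by rewrite -(deRham_classR_re wc wr ac).
split; [exact: closed_form_re|exact: re_form_real|].
apply/J_invariantP; [exact: is_form_re ac.1|exact: has_bidegree11_re].
Qed.

Lemma part10_pure (w : preform 2) c x V S : is_form w -> chart_img c x ->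
  pure J c x S V ->
  part10 J w c x V = if S == finset.setT then w c x V else 0.
Proof.
move=> wf cx pV; case: eqP => [ST|/eqP ST].
  congr (w c x _); apply/row_matrixP => j; rewrite row_mul type10_proj10//.
  by apply: (pure_in pV); rewrite ST inE.
have [j jS] : exists j, j \notin S.
  apply/existsP; apply: contraNT ST => /existsPn E.
  by apply/eqP/setP => j; rewrite inE; have := E j; rewrite negbK.
by apply: (part10_kills01 wf (j := j)) => //; exact: pure_notin pV jS.
Qed.

Lemma part10_bidegree20 (w : preform 2) : is_form w -> has_bidegree J 2 0 (part10 J w).
Proof.
move=> wf c x V S cx pV nS; rewrite (part10_pure wf cx pV) ifN//.
by apply: contra nS => /eqP ->; rewrite finset.setCT cards0 cardsT card_ord.
Qed.

Lemma conj_part10_pure (w : preform 2) c x V S : is_form w -> chart_img c x ->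
  pure J c x S V ->
  conj_form (part10 J w) c x V = if S == finset.set0 then conj_form w c x V else 0.
Proof.
move=> wf cx pV; rewrite /conj_form (part10_pure wf cx (pure_conj pV)).
rewrite -finset.setC0 (inj_eq (@finset.setC_inj _)); case: ifP => // _.
exact: conjc0.
Qed.

Lemma antiinvariant_split (w : preform 2) : is_form w -> real_form w ->
  bidegree_in J (fun p _ => p != 1)%N w ->
  form_eq w (part10 J w + conj_form (part10 J w)).
Proof.
move=> wf wr w1; have w10f := is_form_part10 J wf.
apply: (form_eq_pure (J := J)) => [c x|c x|c x V S cx pV].
- exact: is_form_multilinear.
- exact: is_form_multilinear (is_formD w10f (is_form_conj w10f)).
rewrite /= !fctE (part10_pure wf cx pV) (conj_part10_pure wf cx pV).
rewrite (real_form_conj wf wr)//.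
have T0 : (finset.setT == finset.set0 :> {set 'I_2}) = false.
  by rewrite -cards_eq0 cardsT card_ord.
have [S1|->|->] := subset_ord2 S.
- by rewrite (w1 c x V S)// ?S1// !if_same addr0.
- by rewrite eqxx eq_sym T0 add0r.
- by rewrite eqxx T0 addr0.
Qed.

(** The differential of the (2,0) part vanishes on tuples with two vectors of
    type (0,1), that of its conjugate on tuples with two vectors of type
    (1,0).  A triple is of one of these two kinds, and the sum of the two
    differentials is zero. *)
Lemma closed_part10 (w : preform 2) : closed_form w -> real_form w ->
  bidegree_in J (fun p _ => p != 1)%N w -> closed_form (part10 J w).
Proof.
move=> [wf dw] wr w1; have w10f := is_form_part10 J wf; split; first exact: w10f.
have cwf := is_form_conj w10f.
have k01 := part10_kills01 (J := J) wf.
(* at most one argument of type (1,0), hence at least two of type (0,1) *)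
have kill c x V S : chart_img c x -> pure J c x S V -> (#|S| <= 1)%N ->
    ext_d (part10 J w) c x V = 0.
  move=> cx pV S1.
  have : (1 < #|~: S|)%N by have := cardsC S; rewrite card_ord; lia.
  move=> /card_gt1P[i [j [iS jS ij]]]; rewrite !inE in iS jS.
  by apply: (ext_d2_kills01 J_int w10f k01 cx ij);
    [exact: pure_notin pV iS|exact: pure_notin pV jS].
apply: (form_eq_pure (J := J)) => [c x cx|c x cx|c x V S cx pV].
- exact: ext_d_multilinear w10f cx.
- exact: is_form_multilinear (is_form0 A _) cx.
have [S1|S1] := leqP #|S| 1; first exact: kill _ _ _ _ cx pV S1.
have := dw c x V cx; rewrite (ext_d_ext (antiinvariant_split wf wr w1) V cx) (ext_dD
  w10f cwf V cx).
rewrite /= !fctE (ext_d_conj w10f V cx) /conj_form.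
rewrite (kill _ _ _ _ cx (pure_conj pV)) ?conjc0 ?addr0//.
by have := cardsC S; rewrite card_ord; lia.
Qed.

Lemma HJminusE : HJminus J = real_points
  (subspace_add (dolbeault_subspace J 2 0) (dolbeault_subspace J 0 2)).
Proof.
rewrite -!HJ_dolbeault//; apply/seteqP; split =>
  [_ [w [wc wr wJ] <-]|u [[w [wc wr _] <-]]].
  split; first by exists w.
  have w1 : bidegree_in J (fun p _ => p != 1)%N w by apply/J_antiinvariantP => //;
    exact: wc.1.
  have w20 := closed_part10 wc wr w1.
  have w02 := closed_form_conj w20.
  rewrite complexify_deRham//.
  rewrite (deRham_class_eq (form_eq_cohomologous (antiinvariant_split wc.1 wr w1))).
  rewrite -class_add_deRham//.
  exists (deRham_class (part10 J w)).
    by exists (part10 J w); [split; [exact: w20|exact: part10_bidegree20 wc.1]|].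
  exists (deRham_class (conj_form (part10 J w))); last by [].
  exists (conj_form (part10 J w)); last by [].
  split; first exact: w02.
  by apply: bidegree_inW (bidegree_in_conj (part10_bidegree20 wc.1)) => a b _;
    rewrite andbC.
rewrite complexify_deRham// => -[_ [a [ac a20] <-] [_ [b [bc b02] <-]]].
rewrite class_add_deRham// => E; have abc := closed_formD ac bc.
exists (re_form (a + b)); last by rewrite -(deRham_classR_re wc wr abc).
split; [exact: closed_form_re|exact: re_form_real|].
apply/J_antiinvariantP; first exact: is_form_re abc.1.
apply: bidegree_neq1_re => c x V S cx pV; rewrite negbK => /eqP S1; rewrite /= !fctE.
by rewrite (a20 _ _ _ _ cx pV) ?(b02 _ _ _ _ cx pV) ?addr0// S1.
Qed.

Lemma deRham_class0_HJ p q : HJ J p q (deRham_class 0).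
Proof. by exists 0; [split; [exact: closed_form0|exact: bidegree_in0]|]. Qed.

Lemma dolbeault_class_ext p q (w w' : preform 2) : form_eq w w' ->
  dolbeault_class J p q w = dolbeault_class J p q w'.
Proof.
move=> E; apply/seteqP; split => u [uc [g [gf gp F]]]; (split; first exact: uc);
  exists g; (split; [exact: gf|exact: gp|]);
  by move=> c x V cx; rewrite -F//= !fctE E.
Qed.

(** A closed (2,0) form and the form 0 both have (0,2) component 0, so their de
    Rham classes are identified with the same Dolbeault class of bidegree
    (0,2). *)
Lemma dolbeault_direct : identification_bijective J ->
  dolbeault_subspace J 2 0 `&` dolbeault_subspace J 0 2 = [set deRham_class (0 :
    preform 2)].
Proof.
move=> bij; apply/seteqP; split; last first.
  by move=> _ ->; split; apply: HJ_sub_dolbeault; exact: deRham_class0_HJ.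
move=> e [e20 e02]; have eF := dolbeault_subspace_filtration e02.
move: e20; rewrite -HJ_dolbeault// => -[a [ac a20] aE].
have comp0 : form_eq (component J 0 2 a) 0.
  apply: (form_eq_pure (J := J)) => [c x|c x|c x V S cx pV].
  - exact: component_multilinear ac.1.
  - exact: is_form_multilinear (is_form0 _ _).
  rewrite (component_pureE _ _ ac.1 cx pV); case: ifP => // /andP[/eqP S0 _].
  by rewrite (a20 c x V S)// S0.
pose u := dolbeault_class J 0 2 (component J 0 2 a).
have u0 : u = dolbeault_class J 0 2 (component J 0 2 0).
  apply: dolbeault_class_ext; apply: form_eq_trans comp0 _.
  exact/form_eq_sym/component0.
have du : dolbeault J 0 2 u.
  rewrite u0; exists (component J 0 2 0); last by [].
  by apply: dolbeault_cycle_component; [exact: closed_form0|exact: bidegree_in0].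
have [e' [_ uniq]] := (bij 0%N 2%N erefl).1 u du.
have <- : e' = e.
  apply: uniq; split; first exact: eF.
  exists a; split; [exact: ac|by move=> c x V S cx pV|exact: esym|by []].
apply: uniq; split; first exact/HJ_sub_filtration/deRham_class0_HJ.
exists 0; split; [exact: closed_form0|by move=> c x V S cx pV|by []|exact: u0].
Qed.

End Integrable.
End HodgeClasses.

Theorem proposition2p17 (R : realType) (M : topologicalType)
    (A : atlas R 4 M) (J : almost_complex A)
    (M_hausdorff : hausdorff_space M) (M_compact : compact [set: M])
    (J_integrable : integrable_acs J) :
  [/\ (forall p q : nat, (p + q = 2)%N -> HJ J p q = dolbeault_subspace J p q),
      HJplus J = real_points (dolbeault_subspace J 1 1),
      HJminus J = real_points
        (subspace_add (dolbeault_subspace J 2 0) (dolbeault_subspace J 0 2))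
    & identification_bijective J ->
        dolbeault_subspace J 2 0 `&` dolbeault_subspace J 0 2 =
        [set deRham_class (0 : preform A 2)] ].
Proof.
split.
- exact: HJ_dolbeault.
- exact: HJplusE.
- exact: HJminusE.
- exact: dolbeault_direct.
Qed.
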